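(* For any finite integer sequence $I=(I_1,\ldots,I_r)\in\mathbb Z^r$ and any nonnegative integers $k,l$, the double stable Grothendieck polynomial $G_I$ and the residue polynomial $g_I$ coincide: \[ G_I(\alpha_1,\ldots,\alpha_k;\beta_1,\ldots,\beta_l)=g_I(\alpha_1,\ldots,\alpha_k;\beta_1,\ldots,\beta_l). \]
   Context: **Residue polynomials $g_I$.** Write $\mathrm{Res}_{z=0,\infty} f(z)\,dz=\mathrm{Res}_{z=0} f(z)\,dz+\mathrm{Res}_{z=\infty} f(z)\,dz$. For $I\in\mathbb Z^r$ and nonnegative integers $k,l$, \[ g_I(\alpha_1,\ldots,\alpha_k;\beta_1,\ldots,\beta_l)=\mathrm{Res}_{z_1=0,\infty}\cdots\mathrm{Res}_{z_r=0,\infty}\left(\prod_{j=1}^r(1-z_j)^{I_j-j}\prod_{1\le j<i\le r}\left(1-\frac{z_i}{z_j}\right)\prod_{j=1}^r\frac{\prod_{i=1}^l(1-z_j\beta_i)}{\prod_{i=1}^k(1-z_j\alpha_i)\,(1-z_j)^{l-k}}\prod_{j=1}^r\frac{dz_j}{z_j}\right). \] (The order of the residues is immaterial, since every factor in the denominators depends on a single variable. Here $\alpha_i,\beta_j$ are (generic, nonzero) parameters.) **Double stable Grothendieck polynomials $G_I$** (traditional definition). (1) *Double Grothendieck polynomials $\mathfrak G_w$, $w$ a permutation.* Write $w\in S_n$ as $[w(1),\ldots,w(n)]$, let $\ell(w)=\#\{i<j: w(i)>w(j)\}$, and identify $S_n$ with $\{w\in S_{n+1}: w(n+1)=n+1\}$.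 For the longest element $w_0=[n,n-1,\ldots,1]\in S_n$ put $\mathfrak G_{w_0}=\prod_{i+j\le n}\left(1-\frac{\beta_i}{\alpha_j}\right)$. If $s_i$ is the $i$th elementary transposition and $\ell(ws_i)=\ell(w)+1$, put $\mathfrak G_w=\pi_i(\mathfrak G_{ws_i})$, where \[ \pi_i(f)=\frac{\alpha_i f(\ldots,\alpha_i,\alpha_{i+1},\ldots)-\alpha_{i+1}f(\ldots,\alpha_{i+1},\alpha_i,\ldots)}{\alpha_i-\alpha_{i+1}}. \] (2) *Stable, truncated version.* For $w\in S_n$ let $1^m\times w\in S_{m+n}$ be the identity on $\{1,\ldots,m\}$ and $j\mapsto w(j-m)+m$ for $j>m$. Then $G_w(\alpha_1,\ldots,\alpha_k;\beta_1,\ldots,\beta_l)$ is obtained from $\mathfrak G_{1^m\times w}$ with $m\gg k,l$ by substituting $\alpha_i=1$ for $i>k$ and $\beta_j=1$ for $j>l$. (3) *Partitions.* For a partition $\lambda=(\lambda_1\ge\lambda_2\ge\cdots\ge 0)$ (partitions differing by trailing zeros are identified) and $p$ at least the number of nonzero parts of $\lambda$, let $w_\lambda$ be the Grassmannian permutation with $w_\lambda(i)=i+\lambda_{p+1-i}$ for $i\le p$ and $w_\lambda(i)<w_\lambda(i+1)$ unless $i=p$. Set $G_\lambda=G_{w_\lambda}$ (this is independent of $p$). (4) *Integer sequences.* For an arbitrary finite integer sequence $I$, $G_I$ is defined from the $G_\lambda$ by repeated application of the straightening laws \[ G_{I,p,q,J}=\sum_{k=p+1}^{q}G_{I,q,k,J}-\sum_{k=p+1}^{q-1}G_{I,q-1,k,J}\quad\text{if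 }p<q,\qquad\qquad G_{I,p}=G_{I,0}=G_I\quad\text{if }p<0, \] where $I,J$ denote arbitrary (possibly empty) integer sequences. *)

(* Defs.v *)
From HB Require Import structures.
From mathcomp Require Import all_boot all_order fingroup perm all_algebra.
From mathcomp Require Import mpoly generic_quotient.

Set Implicit Arguments.
Unset Strict Implicit.
Unset Printing Implicit Defensive.

Import Order.TTheory GRing.Theory Num.Theory.
Local Open Scope ring_scope.

Local Notation "x %:F" := (@FracField.tofrac _ x).

Section Residue.
Variable K : fieldType.

(* Coefficient of 'X^n in the power series p / q, for q`_0 != 0: expand
   p / q = (p / q`_0) / (1 - u) with u = 1 - q / q`_0, which has no constant
   term, as a geometric series; only the powers u ^+ i with i <= n matter. *)
Definition series_coef (p q : {poly K}) (n : nat) : K :=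
  ((q`_0)^-1 *: p * \sum_(i < n.+1) (1 - (q`_0)^-1 *: q) ^+ i)`_n.

(* Coefficient of z^-1 in the Laurent expansion at z = 0 of f = p / q: if
   q = 'X^m * q' with q'`_0 != 0, it is the coefficient of 'X^(m - 1) in
   p / q'.  It does not depend on the chosen fraction p / q. *)
Definition res0 (f : {fraction {poly K}}) : K :=
  let p := \n_(repr f) in
  let q := \d_(repr f) in
  if mup 0 q is m.+1 then series_coef p (drop_poly m.+1 q) m else 0.

(* f (1 / z) *)
Definition subst_inv (f : {fraction {poly K}}) : {fraction {poly K}} :=
  let ev (p : {poly K}) : {fraction {poly K}} :=
    (map_poly (fun c : K => (c%:P)%:F) p).[('X%:F)^-1] in
  ev \n_(repr f) / ev \d_(repr f).

(* With w = 1 / z, f(z) dz = - f(1 / w) w^-2 dw. *)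
Definition resoo (f : {fraction {poly K}}) : K :=
  - res0 (subst_inv f / 'X%:F ^+ 2).

Definition res0oo (f : {fraction {poly K}}) : K := res0 f + resoo f.

End Residue.

(* F(z_1)(z_2)...(z_r); the last adjoined variable z_r is the outermost one. *)
Fixpoint iratfun (F : fieldType) (r : nat) : fieldType :=
  if r is r'.+1 then ({fraction {poly iratfun F r'}} : fieldType) else F.

Fixpoint iconst (F : fieldType) (r : nat) (c : F) : iratfun F r :=
  match r return iratfun F r with
  | 0 => c
  | r'.+1 => ((iconst r' c)%:P)%:F
  end.

(* Variables are indexed from 0: [ivar F r j] is z_(j+1) for j < r
   (and the junk value 0 for j >= r). *)
Fixpoint ivar (F : fieldType) (r : nat) (j : nat) : iratfun F r :=
  match r return iratfun F r with
  | 0 => 0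
  | r'.+1 => if j == r' then 'X%:F else ((ivar F r' j)%:P)%:F
  end.

(* Res_{z_1 = 0,oo} ... Res_{z_r = 0,oo} f dz_r ... dz_1 *)
Fixpoint ires0oo (F : fieldType) (r : nat) : iratfun F r -> F :=
  match r return iratfun F r -> F with
  | 0 => fun f => f
  | r'.+1 => fun f => ires0oo (res0oo f)
  end.

Section ResiduePolynomial.
Variables (F : fieldType) (k l : nat).
Variables (alpha : k.-tuple F) (beta : l.-tuple F) (I : seq int).

Local Notation r := (size I).
Local Notation z j := (ivar F r j).
Local Notation "c %:K" := (iconst r c) (at level 2, format "c %:K").

(* Indices start at 0, so that the exponent I_j - j becomes I`_j - (j + 1). *)
Definition g_integrand : iratfun F r :=
  (\prod_(j < r) (1 - z j) ^ (I`_j - j.+1%:Z))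
  * (\prod_(i < r) \prod_(j < r | (j < i)%N) (1 - z i / z j))
  * (\prod_(j < r)
       ((\prod_(b <- beta) (1 - z j * b%:K))
        / ((\prod_(a <- alpha) (1 - z j * a%:K))
           * (1 - z j) ^ (l%:Z - k%:Z))))
  * (\prod_(j < r) (z j)^-1).

Definition g_residue : F := ires0oo g_integrand.

End ResiduePolynomial.

(* Rational functions in alpha_1, ..., alpha_n, beta_1, ..., beta_n. *)
Definition abfun (F : fieldType) (n : nat) := {fraction {mpoly F[n + n]}}.

Section DoubleGrothendieck.
Variables (F : fieldType) (n : nat).

Definition avar (i : 'I_n) : abfun F n := ('X_(lshift n i) : {mpoly F[n + n]})%:F.
Definition bvar (i : 'I_n) : abfun F n := ('X_(rshift n i) : {mpoly F[n + n]})%:F.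

(* f with alpha_i and alpha_j exchanged *)
Definition swap_alpha (i j : 'I_n) (f : abfun F n) : abfun F n :=
  let s := tperm (lshift n i) (lshift n j) in
  (msym s \n_(repr f))%:F / (msym s \d_(repr f))%:F.

(* The operator pi_i when j is the successor of i. *)
Definition pi_op (i j : 'I_n) (f : abfun F n) : abfun F n :=
  (avar i * f - avar j * swap_alpha i j f) / (avar i - avar j).

Definition perm_length (w : 'S_n) : nat :=
  #|[set ij : 'I_n * 'I_n | (ij.1 < ij.2)%N && (w ij.2 < w ij.1)%N]|.

Definition longest_perm : 'S_n := perm (@rev_ord_inj n).

(* [double_groth w f]: f is obtained for w from the two defining rules along
   some chain w < w s_i < ... < w_0.  As (s * t)%g x = t (s x), the function
   composition w s_i is (tperm i j * w)%g with j the successor of i. *)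
Inductive double_groth : 'S_n -> abfun F n -> Prop :=
| double_groth_longest :
    double_groth longest_perm
      (\prod_(i < n) \prod_(j < n | (i.+1 + j.+1 <= n)%N) (1 - bvar i / avar j))
| double_groth_step (w : 'S_n) (i j : 'I_n) (f : abfun F n) :
    j = i.+1 :> nat ->
    perm_length (tperm i j * w)%g = (perm_length w).+1 ->
    double_groth (tperm i j * w)%g f ->
    double_groth w (pi_op i j f).

End DoubleGrothendieck.

(* f is regular at the point v, with value x. *)
Definition has_value (F : fieldType) (n : nat) (f : {fraction {mpoly F[n]}})
    (v : 'I_n -> F) (x : F) : Prop :=
  exists p q : {mpoly F[n]},
    [/\ f = p%:F / q%:F, q.@[v] != 0 & x = p.@[v] / q.@[v]].

(* 1^m x w *)
Definition shift_perm_fun (m n : nat) (w : 'S_n) (i : 'I_(m + n)) : 'I_(m + n) :=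
  match split i with
  | inl j => lshift n j
  | inr j => rshift m (w j)
  end.

Lemma shift_perm_fun_inj (m n : nat) (w : 'S_n) : injective (shift_perm_fun (m := m) w).
Proof.
move=> i j; rewrite /shift_perm_fun.
case: (split_ordP i) => i' ->; case: (split_ordP j) => j' ->.
- by move/lshift_inj ->.
- by move/eqP; rewrite eq_lrshift.
- by move/eqP; rewrite eq_rlshift.
- by move/rshift_inj/perm_inj ->.
Qed.

Definition shift_perm (m n : nat) (w : 'S_n) : 'S_(m + n) :=
  perm (@shift_perm_fun_inj m n w).

Section Stable.
Variables (F : fieldType) (k l : nat).
Variables (alpha : k.-tuple F) (beta : l.-tuple F).

(* alpha_i for i <= k, beta_j for j <= l, and 1 for all other variables *)
Definition truncation_point (n : nat) (i : 'I_(n + n)) : F :=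
  match split i with
  | inl j => nth 1 alpha j
  | inr j => nth 1 beta j
  end.

(* [stable_groth w x]: for all large enough m, substituting in the polynomial
   of 1^m x w gives x. *)
Definition stable_groth (n : nat) (w : 'S_n) (x : F) : Prop :=
  exists M : nat, forall m : nat, (M <= m)%N ->
    exists f : abfun F (m + n),
      double_groth (shift_perm m w) f /\
      has_value f (@truncation_point (m + n)) x.

Definition is_partition (lam : seq int) : bool :=
  sorted >=%R lam && all (fun a => 0 <= a) lam.

(* w = w_lam with descent at p; positions and values are shifted to start
   at 0, and lam is padded with zeros. *)
Definition is_grassmannian (lam : seq int) (p n : nat) (w : 'S_n) : Prop :=
  [/\ (count (fun a : int => a != 0%R) lam <= p <= n)%N,
      forall i : 'I_n, (i < p)%N -> (w i)%:Z = i%:Z + lam`_(p - i.+1)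
    & forall i j : 'I_n, j = i.+1 :> nat -> j != p :> nat -> (w i < w j)%N].

(* [stable_groth_seq I x]: x is a value of G_I obtained from values of the
   G_lam by some sequence of straightenings.  Every admissible choice (of p
   and of the symmetric group containing w_lam, of the law applied and of the
   place where it is applied) is allowed; that G_I is well defined means that
   each I is in relation with exactly one x. *)
Inductive stable_groth_seq : seq int -> F -> Prop :=
| sgs_partition (lam : seq int) (p n : nat) (w : 'S_n) (x : F) :
    is_partition lam ->
    is_grassmannian lam p w ->
    stable_groth w x ->
    stable_groth_seq lam x
| sgs_straighten (I J : seq int) (p q : int) (x y : int -> F) :
    p < q ->
    (forall c : int, p + 1 <= c <= q ->
       stable_groth_seq (I ++ [:: q; c] ++ J) (x c)) ->
    (forall c : int, p + 1 <= c <= q - 1 ->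
       stable_groth_seq (I ++ [:: q - 1; c] ++ J) (y c)) ->
    stable_groth_seq (I ++ [:: p; q] ++ J)
      (\sum_(i < `|(q - p)%R|%N) x (p + 1 + i%:Z)
       - \sum_(i < `|(q - 1 - p)%R|%N) y (p + 1 + i%:Z))
| sgs_trailing (I : seq int) (p : int) (x : F) :
    p <= 0 ->
    stable_groth_seq I x ->
    stable_groth_seq (rcons I p) x.

End Stable.

(* Main.v *)
Require Import Defs.
From HB Require Import structures.
From mathcomp Require Import all_boot all_order fingroup perm all_algebra.
From mathcomp Require Import mpoly generic_quotient.
From mathcomp Require Import ring zify.

Set Implicit Arguments.
Unset Strict Implicit.
Unset Printing Implicit Defensive.

Import Order.TTheory GRing.Theory Num.Theory.
Local Open Scope ring_scope.

(**
  Put psi(z) = prod_i (1 - z beta_i) / (prod_i (1 - z alpha_i) (1 - z)^(l - k)).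
  Up to powers of the z_j the product of the 1 - z_i / z_j is a Vandermonde
  determinant, and the iterated residue of a product of one-variable functions
  is the product of their residues, so (with indices starting at 0)
    g_I = det [Res_(z = 0,oo) (1 - z)^(I_j - j - 1) psi(z) z^(j - i - 1) dz].
  Both straightening laws follow by column operations; applying them makes the
  sequence lexicographically larger inside a fixed box, so they terminate.

  For a partition lam with r parts and a descent at P, the divided differences
  give the bialternant formula, in the variables x_i = 1 / alpha_i,
    G_w det [x_i^j]_(i, j < P) = det [xi_j (x_i)]_(i, j < P),
    xi_j = z^j prod_(s < lam_j + P - 1 - j) (1 - beta_s z).
  The x_i are the roots of B = prod_(i < P) (1 - alpha_i z); hence G_w is the
  determinant of the coefficients of the remainders xi_j mod B, which makes
  sense at the truncation point, where the alpha_i may coincide.  For j >= r,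
  xi_j has degree < P and starts with z^j, so only the first r rows and columns
  matter; and the expansion of (xi_j mod B) / B at 0 turns these coefficients
  into the residues of the determinant g_lam by a unitriangular matrix.
*)

Local Notation "x %:F" := (@FracField.tofrac _ x).

(** * Residues of rational functions in one variable *)

(** Residues, Grothendieck polynomials and $G_I$ are all given through choices: a representative of
    a fraction, a chain up to [longest_perm], a sequence of straightenings. For residues,
    independence comes from the normal form s / z^m + t / q with q(0) nonzero and t / q proper: the
    residues of s / z^m at 0 and oo cancel, and a ratio of top coefficients remains. For chains it
    comes from the braid and commutation relations of [pi_op]. For straightenings it follows from
    the comparison itself, since [g_residue] satisfies every rule.

    The powers of 1 - z in the integrand reflect the truncation: P - k of the alpha_i and v_j - l of
    the beta_s in xi_j become 1, where v_j = lam_j + P - 1 - j.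

    The coefficients of the remainders modulo B must still be evaluated at a point, so the division
    is a pseudo-division over the polynomial ring. Its denominators are powers of the leading
    coefficient of B, up to sign the product of the alpha_i, which does not vanish at the truncation
    point. *)

Section Fractions.
Variable R : idomainType.
Implicit Types (p q : R) (f : {fraction R}).

Lemma frac_repr f : f = (\n_(repr f))%:F / (\d_(repr f))%:F.
Proof.
have d0 : (\d_(repr f))%:F != 0 by rewrite tofrac_eq0 denom_ratioP.
apply: (mulIf d0); rewrite divfK //.
rewrite -{1}[f]reprK; unlock FracField.tofrac.
rewrite -[LHS]FracField.pi_mul; apply/eqmodP => /=.
rewrite FracField.equivfE /FracField.mulf /= !numden_Ratio ?oner_eq0 ?mulr1 ?denom_ratioP //.
by rewrite mulrC.
Qed.

Lemma eq_tofrac_div p q p' q' : q != 0 -> q' != 0 ->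
  (p%:F / q%:F == p'%:F / q'%:F) = (p * q' == p' * q).
Proof.
by move=> q0 q'0; rewrite eqr_div ?tofrac_eq0 // -!rmorphM tofrac_eq.
Qed.

Lemma repr_tofrac_div p q : q != 0 ->
  \n_(repr (p%:F / q%:F)) * q = p * \d_(repr (p%:F / q%:F)).
Proof.
by move=> q0; apply/eqP; rewrite -eq_tofrac_div ?denom_ratioP // -frac_repr.
Qed.

End Fractions.

(** Used in [resooE] after z -> 1 / z: A and Q are the reversals of s and q, and the reversal of t
    is split as x (C Q + x T), which isolates the pole at 0. *)
Lemma inversion_polar_part (L : fieldType) (x A C Q T : L) m e d :
  x != 0 -> Q != 0 ->
  (A / x ^+ e * x ^+ m + x * (C * Q + x * T) / x ^+ d / (Q / x ^+ d)) / x ^+ 2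
    = (x ^+ m * A + C * x ^+ e.+1) / x ^+ e.+2 + T / Q.
Proof.
move=> x0 Q0; rewrite !exprS.
have := expf_neq0 e x0; have := expf_neq0 d x0.
move: (x ^+ e) (x ^+ d) => E D D0 E0.
by field; rewrite x0 Q0 E0 D0.
Qed.

Section OneVariableResidue.
Variable K : fieldType.
Implicit Types (p q s t : {poly K}) (f g : {fraction {poly K}}).

Lemma coefXnMl n p i : (i < n)%N -> ('X^n * p)`_i = 0.
Proof. by move=> lin; rewrite coefXnM lin. Qed.

Lemma coef0_neq0_poly p : p`_0 != 0 -> p != 0.
Proof. by apply: contraNneq => ->; rewrite coef0. Qed.

(** The geometric sum inverts q / q(0) modulo X^(n+1), so any s with p = q s modulo X^(n+1) has the
    coefficient in question. *)
Lemma series_coefP p q s t n : q`_0 != 0 -> p = q * s + 'X^(n.+1) * t ->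
  series_coef p q n = s`_n.
Proof.
move=> q0 ->; rewrite /series_coef; set c := (q`_0)^-1; set u := 1 - c *: q.
have u0 : u`_0 = 0 by rewrite coefB coef1 coefZ /= mulVf // subrr.
have [v uE] : exists v, u = 'X * v.
  exists (drop_poly 1 u); rewrite mulrC -[u in LHS](poly_take_drop 1).
  by rewrite (_ : take_poly 1 u = 0) ?add0r //; apply/polyP=> -[|i];
     rewrite coef_take_poly coef0.
set S := \sum_(i < _) _.
have SE : c *: q * S = 1 - 'X^(n.+1) * v ^+ n.+1.
  have -> : c *: q = 1 - u by rewrite /u subKr.
  by rewrite -exprMn -uE -[RHS]opprB subrX1 -[RHS]mulNr [- (u - 1)]opprB.
move: SE; rewrite -!mul_polyC => SE.
rewrite (_ : _ * S = c%:P * q * S * s + 'X^(n.+1) * (c%:P * t * S)); last by ring.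
rewrite SE mulrBl mul1r -[_ * _ * s]mulrA coefD coefB.
by rewrite !coefXnMl // subr0 addr0.
Qed.

Lemma poly_split0 q : q != 0 ->
  exists2 d, q = 'X^(mup 0 q) * d & d`_0 != 0 /\ d = drop_poly (mup 0 q) q.
Proof.
move=> q0; set m := mup 0 q.
have /dvdpP[d qE] : 'X^m %| q by rewrite -['X]subr0 -[0]polyC0 -mup_geq.
exists d; first by rewrite mulrC.
split; last by rewrite qE drop_polyMXn_id.
apply/negP=> /eqP d0.
have /(leq_ltn_trans (leqnn m)) : (mup 0 q < m.+1)%N by [].
rewrite mup_ltn // => /negP[]; rewrite subr0 qE exprS dvdp_mul //.
rewrite -['X]subr0 -[0]polyC0 dvdp_XsubCl /root horner_coef0 d0 //.
Qed.

Lemma Xn_neq0 n : ('X^n : {poly K}) != 0.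
Proof. by rewrite monic_neq0 ?monicXn. Qed.

Lemma polarpart_frac m s q t : q`_0 != 0 ->
  s%:F / 'X%:F ^+ m + t%:F / q%:F = (s * q + t * 'X^m)%:F / ('X^m * q)%:F.
Proof.
move=> q0; rewrite rmorphD !rmorphM rmorphXn addf_div //.
  by rewrite -rmorphXn tofrac_eq0 Xn_neq0.
by rewrite tofrac_eq0 coef0_neq0_poly.
Qed.

Lemma mulXn_coef0_neq0 m q : q`_0 != 0 -> 'X^m * q != 0.
Proof. by move=> q0; rewrite mulf_neq0 ?Xn_neq0 ?coef0_neq0_poly. Qed.

Lemma dvdXn_coef0 n p q : q`_0 != 0 -> 'X^n %| p * q -> 'X^n %| p.
Proof.
move=> q0; rewrite Gauss_dvdpl // coprimep_expl // coprimep_sym coprimepX.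
by rewrite /root horner_coef0.
Qed.

Lemma coprime_Xn_split m p q : q`_0 != 0 -> exists s t, p = s * q + t * 'X^m.
Proof.
move=> q0; have : coprimep q 'X^m.
  by rewrite coprimep_expr // coprimepX /root horner_coef0.
case/Bezout_eq1_coprimepP=> -[u v] /= e.
by exists (p * u), (p * v); rewrite -!mulrA -mulrDr e mulr1.
Qed.

(* The factor ['X] shifts the index by one, so that the case [m = 0] gives 0. *)
Lemma res0E m s q t : q`_0 != 0 ->
  res0 (s%:F / 'X%:F ^+ m + t%:F / q%:F) = ('X * s)`_m.
Proof.
move=> q0; rewrite polarpart_frac // /res0.
set n := s * q + _; set f := _ / _.
have rE : \n_(repr f) * ('X^m * q) = n * \d_(repr f).
  by apply: repr_tofrac_div; apply: mulXn_coef0_neq0.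
have [d dE [d0 dropE]] := poly_split0 (denom_ratioP (repr f)).
move: rE dE dropE; set N := \n_(repr f); set D := \d_(repr f); set M := mup 0 D.
move=> rE dE dropE; clearbody M D N; clear f.
have [S [T NE]] := coprime_Xn_split M N d0.
(* The chosen representative is S / X^M + T / d, so the two polar parts differ by a fraction whose
   denominator d q is prime to X. *)
have {}rE : (S * 'X^m - s * 'X^M) * (d * q) = 'X^(M + m) * (t * d - T * q).
  move: rE; rewrite {}NE {}dE /n exprD => /eqP; rewrite -subr_eq0 => rE; apply/eqP; rewrite -subr_eq0 -(eqP rE).
  by apply/eqP; ring.
have /dvdpP[u uE] : 'X^(M + m) %| S * 'X^m - s * 'X^M.
  by apply: (@dvdXn_coef0 _ _ (d * q)); rewrite ?coef0M ?mulf_neq0 // rE dvdp_mulr.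
have cE : ('X * S)`_M = ('X * s)`_m.
  have : (('X * (S * 'X^m - s * 'X^M))`_(M + m)) = 0.
    by rewrite uE mulrA coefMXn ltnn subnn coef0M coefX mul0r.
  rewrite mulrBr !mulrA coefB !coefMXn ltnNge leq_addl /= ltnNge leq_addr /=.
  by rewrite addnK addKn => /eqP; rewrite subr_eq0 => /eqP.
rewrite -cE; move: (M) NE dropE => [|M'] NE dropE; first by rewrite coefXM.
by rewrite coefXM /= -dropE; apply: (series_coefP (t := T)); rewrite // NE mulrC [T * _]mulrC.
Qed.

Definition rev_poly n p : {poly K} := \poly_(j < n.+1) p`_(n - j).

Definition horner_inv p : {fraction {poly K}} :=
  (map_poly (@FracField.tofrac _ \o polyC) p).[('X%:F)^-1].

Lemma horner_invM p q : horner_inv (p * q) = horner_inv p * horner_inv q.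
Proof. by rewrite /horner_inv rmorphM hornerM. Qed.

Lemma horner_invD p q : horner_inv (p + q) = horner_inv p + horner_inv q.
Proof. by rewrite /horner_inv rmorphD hornerD. Qed.

Lemma tofracX_neq0 : ('X : {poly K})%:F != 0.
Proof. by rewrite tofrac_eq0 polyX_eq0. Qed.

Lemma tofracXn_neq0 n : ('X : {poly K})%:F ^+ n != 0.
Proof. by rewrite expf_neq0 // tofracX_neq0. Qed.

Lemma horner_invE n p : (size p <= n.+1)%N ->
  horner_inv p = (rev_poly n p)%:F / 'X%:F ^+ n.
Proof.
move=> szp; rewrite /horner_inv (@horner_coef_wide _ n.+1); last first.
  exact: leq_trans (size_poly _ _) szp.
rewrite /rev_poly poly_def rmorph_sum mulr_suml (reindex_inj rev_ord_inj) /=.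
apply: eq_bigr => i _; rewrite subSS coef_map_id0 ?rmorph0 //=.
rewrite -mul_polyC rmorphM rmorphXn /= -mulrA; congr (_ * _).
have lin : (i <= n)%N by rewrite -ltnS.
rewrite exprVn -[in 'X%:F ^+ n](subnK lin) exprD invfM mulrCA.
by rewrite mulfV ?expf_neq0 ?tofracX_neq0 // mulr1.
Qed.

Lemma horner_inv_neq0 p : p != 0 -> horner_inv p != 0.
Proof.
move=> p0; rewrite (@horner_invE (size p).-1) ?leqSpred //.
apply: mulf_neq0; last by rewrite invr_eq0 tofracXn_neq0.
rewrite tofrac_eq0; apply: coef0_neq0_poly; rewrite coef_poly subn0 /= -/(lead_coef p).
by rewrite lead_coef_eq0.
Qed.

Lemma subst_invE p q : q != 0 ->
  subst_inv (p%:F / q%:F) = horner_inv p / horner_inv q.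
Proof.
move=> q0; rewrite /subst_inv -/(horner_inv _) -/(horner_inv _).
apply/eqP; rewrite eqr_div ?horner_inv_neq0 ?denom_ratioP //.
by rewrite -!horner_invM repr_tofrac_div.
Qed.

(** At oo the Laurent part contributes minus its coefficient of 1 / z, and so does t / q, whose
    expansion there starts at 1 / z. *)
Lemma resooE m s q t : q`_0 != 0 -> (size t < size q)%N ->
  resoo (s%:F / 'X%:F ^+ m + t%:F / q%:F)
    = - (('X * s)`_m + t`_(size q).-2 / lead_coef q).
Proof.
move=> q0 szt; have qn0 := coef0_neq0_poly q0.
rewrite /resoo polarpart_frac // subst_invE ?mulXn_coef0_neq0 //; congr (- _).
rewrite horner_invD !horner_invM -addf_div ?horner_inv_neq0 ?Xn_neq0 //.
set d := (size q).-1.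
have szq : size q = d.+1 by rewrite prednK // size_poly_gt0.
have -> : horner_inv 'X^m = ('X%:F ^+ m)^-1.
  rewrite /horner_inv map_polyXn hornerXn exprVn //.
rewrite invrK (@horner_invE (size s)) // (@horner_invE d q) ?szq //.
rewrite (@horner_invE d t); last by rewrite -szq ltnW.
set e := size s; set rq := rev_poly d q; set rt := rev_poly d t.
have rq0 : rq`_0 = lead_coef q.
  by rewrite coef_poly subn0 lead_coefE szq.
have lq0 : lead_coef q != 0 by rewrite lead_coef_eq0.
(* Coefficient of 1 / z in the expansion of t / q at infinity. If d = 0, the index [d.-1] is 0 and t
   = 0. *)
pose c := t`_d.-1 / lead_coef q.
pose t' := drop_poly 1 rt.
pose t'' := drop_poly 1 (t' - c *: rq).
have rtE : rt = 'X * t'.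
  rewrite mulrC -[LHS](poly_take_drop 1) (_ : take_poly 1 rt = 0) ?add0r //.
  apply/polyP=> -[|i]; rewrite coef_take_poly coef0 //= coef_poly subn0 /=.
  by rewrite nth_default // -ltnS -szq.
have t'0 : t'`_0 = t`_d.-1.
  rewrite coef_drop_poly coef_poly add0n ltnS subn1.
  have [d0|//] := posnP d; rewrite d0 /=.
  by rewrite nth_default // -ltnS -d0 -szq.
have t'E : t' = c *: rq + 'X * t''.
  rewrite mulrC -[LHS](subrK (c *: rq)) addrC; congr (_ + _).
  rewrite -[LHS](poly_take_drop 1) (_ : take_poly 1 _ = 0) ?add0r //.
  apply/polyP=> -[|i]; rewrite coef_take_poly coef0 //= coefB coefZ rq0 t'0.
  by rewrite divfK ?subrr.
pose s' := 'X^m * rev_poly e s + c *: 'X^(e.+1).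
have rqn0 : rq != 0 by rewrite coef0_neq0_poly ?rq0.
transitivity (res0 (s'%:F / 'X%:F ^+ (e.+2) + t''%:F / rq%:F)).
  congr res0; rewrite rtE t'E /s' -!mul_polyC; clearbody c.
  rewrite !(rmorphD, rmorphM, rmorphXn) /=.
  rewrite -(@inversion_polar_part _ 'X%:F (rev_poly e s)%:F c%:P%:F rq%:F t''%:F
    m e d tofracX_neq0); first by congr (_ / _).
  by rewrite tofrac_eq0.
rewrite res0E ?rq0 // coefXM /= coefD coefXnM coefZ coefXn eqxx mulr1.
congr (_ + _); rewrite coefXM {s'}; case: m => [|m] /=.
  by rewrite subn0 coef_poly ltnn.
rewrite subSS coef_poly !ltnS leq_subr; case: ltnP => [lt_em|le_me]; last first.
  by rewrite subKn.
by rewrite -/e nth_default // ltnW.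
Qed.

(* The factor ['X] makes the formula correct for constant [q]. *)
Lemma res0ooE m s q t : q`_0 != 0 -> (size t < size q)%N ->
  res0oo (s%:F / 'X%:F ^+ m + t%:F / q%:F)
    = - (('X * t)`_(size q).-1 / lead_coef q).
Proof.
(* The Laurent part s / z^m has opposite residues at 0 and oo. *)
move=> q0 szt; rewrite /res0oo res0E // resooE // opprD addNKr coefXM.
case: (size q) szt => [//|[|n]] //=; rewrite ltnS leqn0 size_poly_eq0 => /eqP ->.
by rewrite coef0.
Qed.

Lemma polar_decomposition f : exists m s q t,
  [/\ q`_0 != 0, (size t < size q)%N & f = s%:F / 'X%:F ^+ m + t%:F / q%:F].
Proof.
rewrite [f]frac_repr; have [d dE [d0 _]] := poly_split0 (denom_ratioP (repr f)).
move: dE; move: (\n_(repr f)) (\d_(repr f)) (mup _ _) => n D m ->.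
have [s [t ->]] := coprime_Xn_split m n d0.
exists m, (s + t %/ d * 'X^m), d, (t %% d); split=> //.
  by rewrite ltn_modp coef0_neq0_poly.
rewrite polarpart_frac //; congr (_%:F / _).
by rewrite {1}(divp_eq t d); ring.
Qed.

Lemma coefM_top p q a b : (size p <= a.+1)%N -> (size q <= b.+1)%N ->
  (p * q)`_(a + b) = p`_a * q`_b.
Proof.
move=> pa qb; rewrite coefM (bigD1 (Ordinal (leq_addr b a : a < (a + b).+1)%N)) //=.
rewrite addKn big1 ?addr0 // => i; rewrite -val_eqE /= neq_ltn => /orP[] lt_ia.
  rewrite [X in _ * X]nth_default ?mulr0 // (leq_trans qb) //.
  by rewrite ltn_subRL ltn_add2r.
by rewrite [X in X * _]nth_default ?mul0r // (leq_trans pa).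
Qed.

(** Both residues work on chosen representatives, so additivity is not formal. Over the common
    denominator q q', the top coefficient of z (t q' + t' q) yields the sum of the two ratios. *)
Lemma res0ooD f g : res0oo (f + g) = res0oo f + res0oo g.
Proof.
have [m [s [q [t [q0 szt ->]]]]] := polar_decomposition f.
have [m' [s' [q' [t' [q'0 szt' ->]]]]] := polar_decomposition g.
have qn0 := coef0_neq0_poly q0; have q'n0 := coef0_neq0_poly q'0.
have szq : size q = (size q).-1.+1 by rewrite prednK // size_poly_gt0.
have szq' : size q' = (size q').-1.+1 by rewrite prednK // size_poly_gt0.
rewrite (_ : _ + _ + (_ + _) = (s * 'X^m' + s' * 'X^m)%:F / 'X%:F ^+ (m + m')
                     + (t * q' + t' * q)%:F / (q * q')%:F); last first.
  rewrite !(rmorphD, rmorphM, rmorphXn) /= exprD -!addf_div ?tofracXn_neq0 ?tofrac_eq0 //.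
  by rewrite addrACA.
rewrite res0ooE ?coef0M ?mulf_neq0 //; last first.
  rewrite size_mul // (leq_ltn_trans (size_polyD _ _)) // gtn_max.
  by rewrite !(leq_ltn_trans (size_polyMleq _ _)) //; move: szt szt'; rewrite szq szq' /=; lia.
rewrite !res0ooE // lead_coefM size_mul // {1}szq {1}szq' addSn addnS /=.
have szX (u v : {poly K}) : (size u < size v)%N -> (size ('X * u)%R <= (size v).-1.+1)%N.
  case: (size v) => // n; rewrite ltnS => un.
  by rewrite (leq_trans (size_polyMleq _ _)) // size_polyX add2n.
rewrite mulrDr coefD !mulrA coefM_top ?szX //; last by rewrite -szq'.
rewrite addnC coefM_top ?szX //; last by rewrite -szq.
rewrite -!lead_coefE -opprD; congr (- _).
by field; rewrite !lead_coef_eq0 qn0 q'n0.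
Qed.

Lemma res0ooZ c f : res0oo (c%:P%:F * f) = c * res0oo f.
Proof.
have [m [s [q [t [q0 szt ->]]]]] := polar_decomposition f.
rewrite mulrDr !mulrA -!rmorphM /= !mul_polyC !res0ooE //; last first.
  exact: leq_ltn_trans (size_scale_leq _ _) szt.
by rewrite -scalerAr coefZ -mulrA mulrN.
Qed.

End OneVariableResidue.

(** Needed for iterated residues: a function of the last variable with coefficients in F has its
    residue in F, although it is computed over the field of the earlier variables. *)
Lemma res0oo_map (K L : fieldType) (phi : {rmorphism K -> L}) (p q : {poly K}) :
  q != 0 -> res0oo ((map_poly phi p)%:F / (map_poly phi q)%:F)
              = phi (res0oo (p%:F / q%:F)).
Proof.
move=> q0; have [m [s [d [t [d0 szt]]]]] := polar_decomposition (p%:F / q%:F).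
have d0' : (map_poly phi d)`_0 != 0 by rewrite coef_map fmorph_eq0.
move=> E; rewrite E res0ooE //; move/eqP: E; rewrite polarpart_frac //.
rewrite eq_tofrac_div ?mulXn_coef0_neq0 // => /eqP /(congr1 (map_poly phi)).
rewrite !(rmorphM, rmorphD) /= !map_polyXn => /eqP.
rewrite -eq_tofrac_div ?mulXn_coef0_neq0 ?map_poly_eq0 // => /eqP ->.
rewrite -polarpart_frac // res0ooE ?size_map_poly //.
have -> : 'X * map_poly phi t = map_poly phi ('X * t) by rewrite rmorphM /= map_polyX.
by rewrite lead_coef_map coef_map /= -fmorph_div -rmorphN.
Qed.

(** * Iterated residues and the determinantal formula *)

Section Iterated.
Variable F : fieldType.

Lemma iconst_is_zmod_morphism r : zmod_morphism (@iconst F r).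
Proof. by elim: r => [|r IHr] x y //=; rewrite IHr !rmorphB. Qed.

Lemma iconst_is_monoid_morphism r : monoid_morphism (@iconst F r).
Proof.
elim: r => [|r [IH1 IHM]]; first by split.
by split=> [|x y] /=; rewrite ?IH1 ?IHM ?rmorph1 ?rmorphM.
Qed.

HB.instance Definition _ r := GRing.isZmodMorphism.Build F (iratfun F r)
  (@iconst F r) (iconst_is_zmod_morphism r).
HB.instance Definition _ r := GRing.isMonoidMorphism.Build F (iratfun F r)
  (@iconst F r) (iconst_is_monoid_morphism r).

Definition ihorner r j (p : {poly F}) : iratfun F r :=
  (map_poly (iconst r) p).[ivar F r j].

Lemma ihorner_is_zmod_morphism r j : zmod_morphism (ihorner r j).
Proof. by move=> p q; rewrite /ihorner rmorphB hornerD hornerN. Qed.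

Lemma ihorner_is_monoid_morphism r j : monoid_morphism (ihorner r j).
Proof.
by split=> [|p q]; rewrite /ihorner ?rmorph1 ?hornerC // rmorphM hornerM.
Qed.

HB.instance Definition _ r j := GRing.isZmodMorphism.Build {poly F} (iratfun F r)
  (ihorner r j) (ihorner_is_zmod_morphism r j).
HB.instance Definition _ r j := GRing.isMonoidMorphism.Build {poly F} (iratfun F r)
  (ihorner r j) (ihorner_is_monoid_morphism r j).

Lemma ihornerX r j : ihorner r j 'X = ivar F r j.
Proof. by rewrite /ihorner map_polyX hornerX. Qed.

Lemma ihornerC r j c : ihorner r j c%:P = iconst r c.
Proof. by rewrite /ihorner map_polyC hornerC. Qed.

Lemma ihorner_last r (p : {poly F}) :
  ihorner r.+1 r p = (map_poly (iconst r) p)%:F.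
Proof.
rewrite /ihorner /= eqxx.
have -> : map_poly (iconst r.+1) p
        = map_poly (@FracField.tofrac _ \o polyC) (map_poly (iconst r) p).
  by rewrite -map_poly_comp.
by rewrite map_poly_comp horner_map -/(comp_poly _ _) comp_polyXr.
Qed.

Lemma ihorner_lift r j (p : {poly F}) : (j < r)%N ->
  ihorner r.+1 j p = ((ihorner r j p)%:P)%:F.
Proof.
move=> ltjr; rewrite /ihorner /= ltn_eqF //.
have -> : map_poly (iconst r.+1) p
        = map_poly (@FracField.tofrac _ \o polyC) (map_poly (iconst r) p).
  by rewrite -map_poly_comp.
by rewrite map_poly_comp !horner_map.
Qed.

Lemma ihorner_neq0 r j (p : {poly F}) : (j < r)%N -> p != 0 -> ihorner r j p != 0.
Proof.
elim: r => // r IHr; rewrite ltnS leq_eqVlt => /predU1P[->|ltjr] p0.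
  by rewrite ihorner_last tofrac_eq0 map_poly_eq0.
by rewrite ihorner_lift // tofrac_eq0 polyC_eq0 IHr.
Qed.

Lemma ires0ooD r (f g : iratfun F r) : ires0oo (f + g) = ires0oo f + ires0oo g.
Proof. by elim: r f g => [|r IHr] f g //=; rewrite res0ooD IHr. Qed.

Lemma ires0ooZ r c (f : iratfun F r) : ires0oo (iconst r c * f) = c * ires0oo f.
Proof. by elim: r f => [|r IHr] f //=; rewrite res0ooZ IHr. Qed.

Lemma ires0oo_sum r (T : finType) (f : T -> iratfun F r) :
  ires0oo (\sum_t f t) = \sum_t ires0oo (f t).
Proof.
apply: (big_morph (@ires0oo F r)) => [x y|]; first exact: ires0ooD.
by rewrite -[X in ires0oo X](mul0r 0) -[X in X * _](rmorph0 (iconst r)) ires0ooZ mul0r.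
Qed.

(** The outermost residue sees the factors in the earlier variables as constants, and by
    [res0oo_map] its own value is a constant for the remaining residues. *)
Lemma ires0oo_prod r (p q : nat -> {poly F}) : (forall j, q j != 0) ->
  ires0oo (\prod_(j < r) (ihorner r j (p j) / ihorner r j (q j)))
    = \prod_(j < r) res0oo ((p j)%:F / (q j)%:F).
Proof.
move=> q0; elim: r => [|r IHr]; first by rewrite !big_ord0.
rewrite [in RHS]big_ord_recr -IHr /= big_ord_recr /= !ihorner_last.
set P := \prod_(i < r) (_ / _).
have -> : P = ((\prod_(j < r) (ihorner r j (p j) / ihorner r j (q j)))%:P)%:F.
  rewrite !rmorph_prod; apply: eq_bigr => j _ /=.
  rewrite !ihorner_lift //; symmetry.
  exact: (fmorph_div (@FracField.tofrac _ \o polyC)).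
by rewrite res0ooZ res0oo_map // mulrC ires0ooZ mulrC.
Qed.

(** Column j involves the variable [ivar F r j] alone, so each Leibniz term is a product over
    separate variables. The transposition indexes the factors by columns. *)
Lemma ires0oo_det r (p q : nat -> nat -> {poly F}) : (forall i j, q i j != 0) ->
  ires0oo (\det (\matrix_(i < r, j < r) (ihorner r j (p i j) / ihorner r j (q i j))))
    = \det (\matrix_(i < r, j < r) res0oo ((p i j)%:F / (q i j)%:F)).
Proof.
move=> q0; rewrite -det_tr -[in RHS]det_tr /determinant ires0oo_sum.
apply: eq_bigr => /= s _.
have -> : (-1) ^+ s = iconst r ((-1) ^+ s : F) by rewrite rmorphXn rmorphN1.
rewrite ires0ooZ; congr (_ * _).
(* [ires0oo_prod] takes families indexed by [nat]; the filler 1 keeps the denominators nonzero. *)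
pose P (f : nat -> nat -> {poly F}) (j : nat) :=
  if insub j is Some j' then f (s j') j else 1.
have PE f (j : 'I_r) : P f j = f (s j) j by rewrite /P valK.
transitivity (ires0oo (\prod_(j < r) (ihorner r j (P p j) / ihorner r j (P q j)))).
  by congr ires0oo; apply: eq_bigr => j _; rewrite !mxE !PE.
rewrite ires0oo_prod; last by move=> j; rewrite /P; case: insub => *; rewrite ?oner_eq0.
by apply: eq_bigr => j _; rewrite !mxE !PE.
Qed.

End Iterated.

Lemma det_scale_cols (R : comNzRingType) n (c : 'I_n -> R) (A : 'M[R]_n) :
  \det (\matrix_(i, j) (c j * A i j)) = (\prod_j c j) * \det A.
Proof.
have -> : \matrix_(i, j) (c j * A i j) = A *m diag_mx (\row_j c j).
  by apply/matrixP=> i j; rewrite mul_mx_diag !mxE mulrC.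
by rewrite det_mulmx det_diag mulrC; congr (_ * _); apply: eq_bigr => j _; rewrite mxE.
Qed.

(** A Vandermonde determinant in the 1 / z_j: the j factors z_j taken out of column j are shared
    among the pairs i < j, as z_j (1 / z_j - 1 / z_i) = 1 - z_j / z_i. *)
Lemma det_quotients (L : fieldType) n (z : 'I_n -> L) : (forall j, z j != 0) ->
  \det (\matrix_(i, j) (z j ^+ j / z j ^+ i))
    = \prod_(i < n) \prod_(j < n | (j < i)%N) (1 - z i / z j).
Proof.
move=> z0; pose V : 'M[L]_n := Vandermonde n (\row_j (z j)^-1).
have -> : \matrix_(i, j) (z j ^+ j / z j ^+ i) = \matrix_(i, j) (z j ^+ j * V i j).
  by apply/matrixP=> i j; rewrite !mxE exprVn.
rewrite det_scale_cols det_Vandermonde (exchange_big_dep xpredT) //= -big_split /=.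
apply: eq_bigr => j _.
have -> : z j ^+ j = \prod_(i < n | (i < j)%N) z j.
  by rewrite (big_ord_narrow (ltnW (ltn_ord j))) prodr_const card_ord.
rewrite -big_split /=; apply: eq_bigr => i _; rewrite !mxE mulrBr mulfV //.
Qed.

Lemma entry_split (L : fieldType) (A B Z U V : L) :
  U * A / (Z * V * B) = A / B / Z * (U / V).
Proof. by rewrite !invfM; ring. Qed.

Lemma factor_split (L : fieldType) (A B N D U V Z : L) : N / D = U / V ->
  U * (A / (B * V) / Z) = N * A / (D * B) / Z.
Proof.
move=> E; rewrite !invfM; transitivity (U / V * A / B / Z); first by ring.
by rewrite -E; ring.
Qed.

Section Determinant.
Variables (F : fieldType) (k l : nat) (alpha : k.-tuple F) (beta : l.-tuple F).

Definition onemX_num (e : int) : {poly F} := if e is Posz n then (1 - 'X) ^+ n else 1.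
Definition onemX_den (e : int) : {poly F} := if e is Negz n then (1 - 'X) ^+ n.+1 else 1.

Definition linear_prod (s : seq F) : {poly F} := \prod_(c <- s) (1 - c *: 'X).

(* [psi_num a / psi_den a] is (1 - z)^a times the factor of the integrand that
   contains the parameters. *)
Definition psi_num (a : int) := onemX_num (a - l%:Z + k%:Z) * linear_prod beta.
Definition psi_den (a : int) := onemX_den (a - l%:Z + k%:Z) * linear_prod alpha.

Definition res_entry (a : int) (i j : nat) : F :=
  res0oo (('X^j * psi_num a)%:F / ('X^(i.+1) * psi_den a)%:F).

Lemma oneBX_coef0 (c : F) : (1 - c *: 'X)`_0 = 1.
Proof. by rewrite coefB coef1 coefZ coefX mulr0 subr0. Qed.

Lemma coef0_prod (T : Type) (s : seq T) (f : T -> {poly F}) :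
  (\prod_(x <- s) f x)`_0 = \prod_(x <- s) (f x)`_0.
Proof. by rewrite -horner_coef0 horner_prod; apply: eq_bigr => x _; rewrite horner_coef0. Qed.

Lemma linear_prod_coef0 s : (linear_prod s)`_0 = 1.
Proof. by rewrite coef0_prod big1 // => c _; rewrite oneBX_coef0. Qed.

Lemma oneBXn_coef0 n : ((1 - 'X : {poly F}) ^+ n)`_0 = 1.
Proof. by rewrite -horner_coef0 !hornerE subr0 expr1n. Qed.

Lemma psi_den_coef0 a : (psi_den a)`_0 = 1.
Proof.
rewrite coef0M linear_prod_coef0 mulr1 /onemX_den.
by case: (a - _ + _) => n; rewrite ?coef1 ?oneBXn_coef0.
Qed.

Lemma psi_den_neq0 a : psi_den a != 0.
Proof. by apply: coef0_neq0_poly; rewrite psi_den_coef0 oner_eq0. Qed.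

Lemma ihorner_linear_prod r j s :
  ihorner r j (linear_prod s) = \prod_(c <- s) (1 - ivar F r j * iconst r c).
Proof.
rewrite /linear_prod rmorph_prod; apply: eq_bigr => c _ /=.
by rewrite -mul_polyC rmorphB rmorph1 rmorphM /= ihornerC ihornerX mulrC.
Qed.

Lemma ihorner_onemX r j e :
  ihorner r j (onemX_num e) / ihorner r j (onemX_den e) = (1 - ivar F r j) ^ e.
Proof.
have hX : ihorner r j (1 - 'X) = 1 - ivar F r j by rewrite rmorphB rmorph1 /= ihornerX.
case: e => n; rewrite /onemX_num /onemX_den rmorphXn rmorph1 /= hX ?divr1 //.
by rewrite div1r.
Qed.

Lemma g_residue_det (I : seq int) :
  g_residue alpha beta I
    = \det (\matrix_(i < size I, j < size I) res_entry (I`_j - j.+1%:Z) i j).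
Proof.
set r := size I.
rewrite /g_residue -/r -(@ires0oo_det _ _ (fun i j => 'X^j * psi_num (I`_j - j.+1%:Z))
  (fun i j => 'X^(i.+1) * psi_den (I`_j - j.+1%:Z))); last first.
  by move=> i j; rewrite mulf_neq0 ?psi_den_neq0 ?Xn_neq0.
congr ires0oo; rewrite /g_integrand.
pose z (j : 'I_r) : iratfun F r := ivar F r j.
have z0 j : z j != 0 by rewrite /z -ihornerX ihorner_neq0 ?polyX_eq0.
(* The part of an entry of column j that is independent of the row; it includes the 1 / z_j of dz_j
   / z_j. *)
pose c (j : 'I_r) : iratfun F r :=
  ihorner r j (psi_num (I`_j - j.+1%:Z)) / ihorner r j (psi_den (I`_j - j.+1%:Z)) / z j.
have -> : \matrix_(i < r, j < r)
      (ihorner r j ('X^j * psi_num (I`_j - j.+1%:Z))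
       / ihorner r j ('X^(i.+1) * psi_den (I`_j - j.+1%:Z)))
    = \matrix_(i < r, j < r) (c j * (\matrix_(i < r, j < r) (z j ^+ j / z j ^+ i)) i j).
  apply/matrixP => i j; rewrite !mxE [ihorner _ _ ('X^j * _)]rmorphM.
  rewrite [ihorner _ _ ('X^(_.+1) * _)]rmorphM !rmorphXn /= !ihornerX -/(z j) /c exprS.
  by apply: entry_split.
rewrite det_scale_cols det_quotients // [RHS]mulrC.
set A := (X in X * _ * _ * _ = _); set B := (X in _ * X * _ * _ = _).
rewrite [A * B]mulrC -!mulrA; congr (_ * _); rewrite /A.
rewrite -!big_split /=; apply: eq_bigr => j _; rewrite -/(z j) /c !rmorphM /=.
rewrite !ihorner_linear_prod; apply: factor_split.
have y0 : 1 - z j != 0.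
  rewrite /z -ihornerX -(rmorph1 (ihorner r j)) -rmorphB ihorner_neq0 //.
  by apply: coef0_neq0_poly; rewrite coefB coef1 coefX subr0 oner_eq0.
by rewrite ihorner_onemX invr_expz -expfzDr // opprB addrA addrAC.
Qed.

End Determinant.

(** * Straightening laws for residue polynomials *)

Lemma addf_tofrac (R : idomainType) (p1 q1 p2 q2 p q : R) :
  q1 != 0 -> q2 != 0 -> q != 0 -> (p1 * q2 + p2 * q1) * q = p * (q1 * q2) ->
  p1%:F / q1%:F + p2%:F / q2%:F = p%:F / q%:F.
Proof.
move=> q10 q20 q0 E; rewrite addf_div ?tofrac_eq0 // -!rmorphM -rmorphD.
by apply/eqP; rewrite /= eq_tofrac_div ?mulf_neq0 // E.
Qed.

Lemma lift_eqF n (h : 'I_n) c : (lift h c == h :> nat) = false.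
Proof. by rewrite val_eqE eq_sym (negPf (neq_lift h c)). Qed.

Section TwoRows.
Variables (R : comNzRingType) (n j : nat) (f : nat -> nat -> R).
Hypothesis ltjn : (j.+1 < n)%N.

(** A straightening law changes two adjacent rows of the transposed matrix. With the others frozen
    in [f], the determinant is an alternating bilinear form in these two. *)
Definition det2 (x y : nat -> R) : R :=
  \det (\matrix_(c < n, i < n)
          if c == j :> nat then x i else if c == j.+1 :> nat then y i else f c i).

Let j0 : 'I_n := Ordinal (ltnW ltjn).
Let j1 : 'I_n := Ordinal ltjn.

Lemma det2Bl x x' y : det2 (fun i => x i - x' i) y = det2 x y - det2 x' y.
Proof.
rewrite -[det2 x y]mul1r -[det2 x' y]mul1r -mulNr.
apply: (@determinant_multilinear _ _ _ _ _ j0); apply/matrixP => c i; rewrite !mxE.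
- by rewrite eqxx mul1r mulN1r.
- by rewrite (lift_eqF j0 c).
- by rewrite (lift_eqF j0 c).
Qed.

Lemma det2Br x y y' : det2 x (fun i => y i - y' i) = det2 x y - det2 x y'.
Proof.
rewrite -[det2 x y]mul1r -[det2 x y']mul1r -mulNr.
apply: (@determinant_multilinear _ _ _ _ _ j1); apply/matrixP => c i; rewrite !mxE.
- by rewrite /= gtn_eqF // eqxx mul1r mulN1r.
- by rewrite (lift_eqF j1 c).
- by rewrite (lift_eqF j1 c).
Qed.

Lemma det2_alt x : det2 x x = 0.
Proof.
apply: (@determinant_alternate _ _ _ j0 j1) => [|i]; first by rewrite -val_eqE /= ltn_eqF.
by rewrite !mxE /= !eqxx; case: ifP.
Qed.

Lemma det2C x y : det2 x y = - det2 y x.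
Proof.
apply/eqP; rewrite -subr_eq0 opprK; apply/eqP.
have := det2_alt (fun i => x i - y i).
rewrite det2Bl !det2Br !det2_alt sub0r subr0 => /eqP.
by rewrite -opprD oppr_eq0 => /eqP.
Qed.

End TwoRows.

Lemma sum_int_telescope (V : zmodType) (d : int -> V) (b : int) (f : nat -> V) m :
  (forall i, f i = d (b + i%:Z) - d (b + i%:Z + 1)) ->
  \sum_(i < m) f i = d b - d (b + m%:Z).
Proof.
move=> E; elim: m => [|m IHm]; first by rewrite big_ord0 addr0 subrr.
by rewrite big_ord_recr /= IHm E addrA subrK -addrA -PoszD addn1.
Qed.

Section Laws.
Variables (F : fieldType) (k l : nat) (alpha : k.-tuple F) (beta : l.-tuple F).
Local Notation res_entry := (res_entry alpha beta).
Local Notation psi_num := (psi_num k beta).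
Local Notation psi_den := (psi_den l alpha).
Local Notation g := (g_residue alpha beta).

Lemma onemX_succ (e : int) :
  onemX_num F (e + 1) * onemX_den F e = (1 - 'X) * onemX_num F e * onemX_den F (e + 1).
Proof.
case: e => [n|[|n]].
- by rewrite -PoszD addn1 /= !mulr1 exprS.
- by rewrite (_ : Negz 0 + 1 = 0) //= !mulr1 mul1r expr1.
rewrite (_ : Negz n.+1 + 1 = Negz n) /= ?mul1r ?mulr1 ?exprS //.
by rewrite !NegzE; lia.
Qed.

Lemma psi_succ (a : int) :
  psi_num (a + 1) * psi_den a = (1 - 'X) * psi_num a * psi_den (a + 1).
Proof.
rewrite /psi_num /psi_den.
rewrite (_ : a + 1 - l%:Z + k%:Z = a - l%:Z + k%:Z + 1); last by ring.
by rewrite mulrACA onemX_succ; ring.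
Qed.

(** z (1 - z)^a = (1 - z)^a - (1 - z)^(a+1). *)
Lemma res_entry_succ (a : int) i j :
  res_entry a i j.+1 = res_entry a i j - res_entry (a + 1) i j.
Proof.
apply/eqP; rewrite eq_sym subr_eq /res_entry -res0ooD; apply/eqP; congr res0oo.
have X0 n : ('X^n : {poly F}) != 0 by apply: Xn_neq0.
have d0 b : psi_den b != 0 by apply: psi_den_neq0.
symmetry; apply: addf_tofrac; try by apply: mulf_neq0.
rewrite exprS; move: (psi_succ a) => E.
transitivity ('X^j * 'X^(i.+1) ^+ 2 * psi_den a * ('X * psi_num a * psi_den (a + 1)
  + psi_num (a + 1) * psi_den a)); first by ring.
by rewrite E; ring.
Qed.

Lemma g_residue_detT (I : seq int) n : size I = n ->
  g I = \det (\matrix_(c < n, i < n) res_entry (I`_c - c.+1%:Z) i c).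
Proof.
by move=> <-; rewrite g_residue_det -det_tr; congr (\det _); apply/matrixP=> i j; rewrite !mxE.
Qed.

(** Write [a, b] for the form [det2] at [U a], [U b]. By [res_entry_succ], adjacent entries a, b of
    the sequence give [a, b - 1] - [a, b]. The sums over the second entry therefore telescope to
    [q, p] - [q, q] and [q - 1, p] - [q - 1, q - 1], and alternation turns their difference into
    [p, q - 1] - [p, q]. *)
Lemma g_residue_straighten (I J : seq int) (p q : int) : p < q ->
  g (I ++ [:: p; q] ++ J)
    = \sum_(i < `|(q - p)%R|%N) g (I ++ [:: q; p + 1 + i%:Z] ++ J)
      - \sum_(i < `|(q - 1 - p)%R|%N) g (I ++ [:: q - 1; p + 1 + i%:Z] ++ J).
Proof.
move=> ltpq; set j := size I; pose n := (j + (size J).+2)%N.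
have ltjn : (j.+1 < n)%N by rewrite /n -addn1 ltn_add2l.
pose U (a : int) i := res_entry (a - j.+1%:Z) i j.
(* The two zeros are placeholders: [det2] overwrites these rows. *)
pose f c i := res_entry ((I ++ [:: 0; 0] ++ J)`_c - c.+1%:Z) i c.
have aux (x y : nat) : (y <= x -> x != y -> x != y.+1 -> x - y = (x - y.+2).+2)%N by lia.
have auxz (x : int) : (x - 1 - j.+1%:Z = x - j.+2%:Z) /\ (x - j.+2%:Z + 1 = x - j.+1%:Z) by lia.
have gE a b : g (I ++ [:: a; b] ++ J) = det2 n j f (U a) (U (b - 1)) - det2 n j f (U a) (U b).
  rewrite -det2Br // (@g_residue_detT _ n); last by rewrite size_cat.
  congr (\det _); apply/matrixP => c i; rewrite !mxE.
  have [->|neq_cj] := eqVneq (c : nat) j.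
    by rewrite nth_cat ltnn subnn.
  have [->|neq_cj1] := eqVneq (c : nat) j.+1.
    rewrite nth_cat ltnNge leqnSn /= subSnn /= res_entry_succ /U.
    by rewrite (auxz b).1 (auxz b).2.
  rewrite /f !nth_cat -/j; case: ltnP => [//|le_jc].
  by rewrite (aux _ _ le_jc neq_cj neq_cj1).
have tel (a b : int) m : \sum_(i < m) g (I ++ [:: a; b + 1 + i%:Z] ++ J)
    = det2 n j f (U a) (U b) - det2 n j f (U a) (U (b + m%:Z)).
  apply: (sum_int_telescope (d := fun b => det2 n j f (U a) (U b))
    (f := fun i => g (I ++ [:: a; b + 1 + i%:Z] ++ J))) => i.
  have [e1 e2] : b + 1 + i%:Z - 1 = b + i%:Z /\ b + 1 + i%:Z = b + i%:Z + 1 by lia.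
  by rewrite gE e1 e2.
have e1 : p + `|(q - p)%R|%N%:Z = q by lia.
have e2 : p + `|(q - 1 - p)%R|%N%:Z = q - 1 by lia.
rewrite !tel gE e1 e2; move: (U p) (U q) (U (q - 1)) => up uq uq'.
rewrite [det2 _ _ _ uq uq]det2_alt // [det2 _ _ _ uq' uq']det2_alt // !subr0.
by rewrite (det2C _ ltjn) [X in _ - X](det2C _ ltjn) opprK addrC.
Qed.
Lemma size_linear_prod_leq (s : seq F) : (size (linear_prod s) <= (size s).+1)%N.
Proof.
elim: s => [|c s IHs]; first by rewrite /linear_prod big_nil size_poly1.
rewrite /linear_prod big_cons -/(linear_prod s).
apply: leq_trans (size_polyMleq _ _) _ => /=.
have : (size (1 - c *: 'X)%R <= 2)%N.
  rewrite (leq_trans (size_polyD _ _)) // geq_max size_poly1 size_polyN.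
  by rewrite (leq_trans (size_scale_leq _ _)) // size_polyX.
by move=> sz2; rewrite -subn1 leq_subLR; apply: leq_trans (leq_add sz2 IHs) _.
Qed.

Lemma size_linear_prod (s : seq F) : all (fun c => c != 0) s ->
  size (linear_prod s) = (size s).+1.
Proof.
elim: s => [|c s IHs] /=; first by rewrite /linear_prod big_nil size_poly1.
case/andP=> c0 s0; rewrite /linear_prod big_cons -/(linear_prod s).
have sz2 : size (1 - c *: 'X) = 2.
  have szc : size (- (c *: 'X)) = 2 by rewrite size_polyN size_scale // size_polyX.
  by rewrite addrC size_polyDl szc // size_poly1.
rewrite size_mul ?IHs ?sz2 -?size_poly_gt0 ?sz2 ?IHs //.
Qed.

Lemma onemX_linear_prod n : (1 - 'X) ^+ n = linear_prod (nseq n 1) :> {poly F}.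
Proof. by rewrite /linear_prod big_nseq iter_mulr_1 scale1r. Qed.

Lemma linear_prod_cat (s1 s2 : seq F) :
  linear_prod (s1 ++ s2) = linear_prod s1 * linear_prod s2.
Proof. exact: big_cat. Qed.

Hypothesis alpha0 : all (fun c => c != 0) alpha.

(** At infinity the quotient is at most of order z^a: the nonzero alpha_i give the denominator its
    full degree, and the powers of 1 - z account for l - k. *)
Lemma size_psi a m : a <= - m%:Z -> (size (psi_num a) + m <= size (psi_den a))%N.
Proof.
move=> le_am; have szb := size_tuple beta; have sza := size_tuple alpha.
rewrite /psi_num /psi_den /onemX_num /onemX_den.
have onen (s : seq F) : 1 * linear_prod s = linear_prod (nseq 0 1 ++ s) by rewrite mul1r.
case E : (a - l%:Z + k%:Z) => [n|n]; rewrite onen onemX_linear_prod -linear_prod_cat.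
  rewrite [size (linear_prod (_ ++ alpha))]size_linear_prod //.
  have := size_linear_prod_leq (nseq n 1 ++ beta).
  by rewrite !size_cat !size_nseq szb /= sza; lia.
rewrite [size (linear_prod (_ ++ alpha))]size_linear_prod; last first.
  by rewrite all_cat alpha0 all_nseq oner_eq0 orbT.
have := size_linear_prod_leq beta.
by rewrite !size_cat !size_nseq szb sza; move: E; rewrite NegzE /=; lia.
Qed.

Lemma psi_num_coef0 a : (psi_num a)`_0 = 1.
Proof.
rewrite coef0M linear_prod_coef0 mulr1 /onemX_num.
by case: (a - _ + _) => n; rewrite ?coef1 ?oneBXn_coef0.
Qed.

(** At infinity the function is O(z^-2), so there is no residue. At 0 there is a pole only for i =
    r, where it is simple with residue 1. *)
Lemma res_entry_trailing a i r : (i <= r)%N -> a <= - (r.+1)%:Z ->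
  res_entry a i r = (i == r)%:R.
Proof.
move=> le_ir /size_psi; rewrite /res_entry.
have d1 := psi_den_coef0 l alpha a; have n1 := psi_num_coef0 a.
have dn0 := psi_den_neq0 l alpha a.
move: (psi_num a) (psi_den a) d1 n1 dn0 => n d d1 n1 dn0 sz.
have lt_nd : (size n < size d)%N by lia.
have X0 m : ('X^m : {poly F}) != 0 by apply: Xn_neq0.
move: le_ir; rewrite leq_eqVlt => /predU1P[->|lt_ir].
  (* Both constant terms are 1, so n / d = 1 + X t / d and the function is 1 / z + t / d. *)
  rewrite eqxx; pose t := drop_poly 1 (n - d).
  have szt : (size t < size d)%N.
    rewrite size_drop_poly subn1; case E : (size (n - d)) => [|m] /=; first exact: leq_ltn_trans lt_nd.
    by rewrite -E (leq_trans (size_polyD _ _)) // geq_max size_polyN leqnn ltnW.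
  have nE : n = d + 'X * t.
    rewrite mulrC -[LHS](subrK d) addrC; congr (_ + _).
    rewrite -[LHS](poly_take_drop 1) (_ : take_poly 1 _ = 0) ?add0r //.
    by apply/polyP=> -[|j]; rewrite coef_take_poly coef0 //= coefB n1 d1 subrr.
  clearbody t.
  have -> : ('X^r * n)%:F / ('X^(r.+1) * d)%:F = 1%:F / 'X%:F ^+ 1 + t%:F / d%:F.
    rewrite polarpart_frac ?d1 ?oner_eq0 //; apply/eqP.
    by rewrite eq_tofrac_div ?mulf_neq0 // nE ['X^(r.+1)]exprS; apply/eqP; ring.
  rewrite res0ooE ?d1 ?oner_eq0 //.
  have -> : 'X * t = n - d by rewrite nE addrC addKr.
  rewrite coefB nth_default ?sub0r; last by move: lt_nd; case: (size d) => // m; rewrite ltnS.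
  by rewrite mulNr opprK -lead_coefE mulfV ?lead_coef_eq0.
rewrite ltn_eqF //.
have -> : ('X^r * n)%:F / ('X^(i.+1) * d)%:F
        = 0%:F / 'X%:F ^+ 0 + ('X^(r - i.+1) * n)%:F / d%:F.
  rewrite polarpart_frac ?d1 ?oner_eq0 //; apply/eqP.
  rewrite eq_tofrac_div ?mulf_neq0 // -[in 'X^r](subnK lt_ir) exprD expr0.
  by apply/eqP; ring.
have szX : (size ('X^(r - i.+1) * n)%R < (size d).-1)%N.
  by apply: leq_ltn_trans (size_polyMleq _ _) _; rewrite size_polyXn; lia.
rewrite res0ooE ?d1 ?oner_eq0 //; last exact: leq_trans szX (leq_pred _).
by rewrite coefXM nth_default ?if_same ?mul0r ?oppr0 // -ltnS (ltn_predK szX).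
Qed.

Lemma g_residue_trailing (I : seq int) (p : int) : p <= 0 -> g (rcons I p) = g I.
Proof.
move=> p0; rewrite (@g_residue_detT _ (size I).+1) ?size_rcons // (@g_residue_detT I (size I)) //.
rewrite (expand_det_row _ ord_max) (bigD1 ord_max) //= big1 ?addr0 => [|i].
  rewrite !mxE /= nth_rcons ltnn eqxx res_entry_trailing //; last by lia.
  rewrite eqxx mul1r /cofactor addnn -signr_odd odd_double mul1r.
  congr (\det _); apply/matrixP => c i; rewrite !mxE.
  by rewrite !lift_max nth_rcons ltn_ord.
move=> neq; rewrite !mxE /= nth_rcons ltnn eqxx res_entry_trailing ?leq_ord //; last by lia.
by rewrite (_ : (_ == _) = false) ?mul0r //; apply: contraNF neq => /eqP e; apply/eqP/val_inj.
Qed.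

End Laws.

(** * Demazure operators and the length function *)

(** The formula of [swap_alpha] for an arbitrary permutation of the variables; [sactE] frees it from
    the chosen representative. *)
HB.lock Definition sact (F : fieldType) (m : nat) (s : 'S_m)
    (f : {fraction {mpoly F[m]}}) : {fraction {mpoly F[m]}} :=
  (msym s \n_(repr f))%:F / (msym s \d_(repr f))%:F.

Section PermutationAction.
Variables (F : fieldType) (m : nat).
Implicit Types (s t : 'S_m) (f g : {fraction {mpoly F[m]}}) (p q : {mpoly F[m]}).

Lemma msym_eq0 s p : (msym s p == 0) = (p == 0).
Proof. by rewrite -[X in _ == X](msym0 _ s) (inj_eq (@inj_msym _ _ s)). Qed.

Lemma sactE s p q : q != 0 -> sact s (p%:F / q%:F) = (msym s p)%:F / (msym s q)%:F.
Proof.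
move=> q0; rewrite sact.unlock; apply/eqP; rewrite eq_tofrac_div ?msym_eq0 ?denom_ratioP //.
by rewrite -!msymM repr_tofrac_div.
Qed.

Lemma sact_tofrac s p : sact s p%:F = (msym s p)%:F.
Proof.
have := sactE s p (oner_neq0 {mpoly F[m]}).
by rewrite msym1 !tofrac1 !divr1.
Qed.

Lemma sact_is_zmod_morphism s : zmod_morphism (@sact F m s).
Proof.
move=> f g; rewrite [f]frac_repr [g]frac_repr.
move: (denom_ratioP (repr f)) (denom_ratioP (repr g)).
move: (\n_(repr f)) (\d_(repr f)) (\n_(repr g)) (\d_(repr g)) => a b c d b0 d0.
rewrite -mulNr -rmorphN addf_div ?tofrac_eq0 // -!rmorphM -rmorphD /=.
rewrite !sactE ?mulf_neq0 // msymD !msymM msymN rmorphD !rmorphM rmorphN.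
by rewrite -[X in _ = _ + X]mulNr addf_div ?tofrac_eq0 ?msym_eq0.
Qed.

Lemma sact_is_monoid_morphism s : monoid_morphism (@sact F m s).
Proof.
split=> [|f g]; first by rewrite -tofrac1 sact_tofrac msym1.
rewrite [f]frac_repr [g]frac_repr.
move: (denom_ratioP (repr f)) (denom_ratioP (repr g)).
move: (\n_(repr f)) (\d_(repr f)) (\n_(repr g)) (\d_(repr g)) => a b c d b0 d0.
by rewrite mulf_div -!rmorphM /= !sactE ?mulf_neq0 // !msymM !rmorphM mulf_div.
Qed.

HB.instance Definition _ s := GRing.isZmodMorphism.Build
  {fraction {mpoly F[m]}} {fraction {mpoly F[m]}} (@sact F m s) (sact_is_zmod_morphism s).
HB.instance Definition _ s := GRing.isMonoidMorphism.Build
  {fraction {mpoly F[m]}} {fraction {mpoly F[m]}} (@sact F m s) (sact_is_monoid_morphism s).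

Lemma sactM s t f : sact (s * t)%g f = sact t (sact s f).
Proof.
rewrite [f]frac_repr; move: (denom_ratioP (repr f)).
move: (\n_(repr f)) (\d_(repr f)) => a b b0.
rewrite (sactE (s * t)%g a b0).
rewrite (sactE s a b0).
have b0' : msym s b != 0 by rewrite msym_eq0.
rewrite (sactE t _ b0').
by rewrite 2!msymMm.
Qed.

Lemma sact1 f : sact 1%g f = f.
Proof. by rewrite sact.unlock !msym1m -frac_repr. Qed.

Lemma sactX s i : sact s ('X_i : {mpoly F[m]})%:F = ('X_(s i) : {mpoly F[m]})%:F.
Proof.
rewrite sact_tofrac msymX; congr (('X_[_])%:F); apply/mnmP=> j; rewrite mnmE !mnm1E.
by rewrite -(inj_eq (@perm_inj _ s)) permKV.
Qed.

End PermutationAction.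

Section Demazure.
Variable L : fieldType.
Implicit Types (s t : {rmorphism L -> L}) (a b c d f : L).

(** The operator pi_i over an abstract field, with a morphism s in place of the exchange of
    variables: the relations below become identities that [field] can check. *)
Definition demazure s a b f := (a * f - b * s f) / (a - b).

Lemma demazure_sym s a b f : (forall x, s (s x) = x) -> s a = b -> s b = a ->
  s (demazure s a b f) = demazure s a b f.
Proof.
move=> ss sa sb; rewrite /demazure fmorph_div !rmorphB !rmorphM ss sa sb.
by rewrite -[b - a]opprB -[b * _ - _]opprB invrN mulrNN.
Qed.

Lemma demazure_mul s a b u f : s u = u -> demazure s a b (u * f) = u * demazure s a b f.
Proof. by move=> su; rewrite /demazure rmorphM su; ring. Qed.

Lemma demazure_comm s t a b c d f : a != b -> c != d ->
  (forall x, s (t x) = t (s x)) -> s c = c -> s d = d -> t a = a -> t b = b ->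
  demazure s a b (demazure t c d f) = demazure t c d (demazure s a b f).
Proof.
rewrite -subr_eq0 -[c == d]subr_eq0 => ab cd st sc sd ta tb; rewrite /demazure.
rewrite !(fmorphV, rmorphB, rmorphM) /= sc sd ta tb st.
by field; rewrite ab cd.
Qed.

Lemma demazure_braid s t a b c f : a != b -> b != c -> a != c ->
  (forall x, s (s x) = x) -> (forall x, t (t x) = x) ->
  (forall x, s (t (s x)) = t (s (t x))) ->
  s a = b -> s b = a -> s c = c -> t a = a -> t b = c -> t c = b ->
  demazure s a b (demazure t b c (demazure s a b f))
    = demazure t b c (demazure s a b (demazure t b c f)).
Proof.
rewrite -subr_eq0 -[b == c]subr_eq0 -[a == c]subr_eq0 => ab bc ac ss tt sts.
move=> sa sb sc ta tb tc; rewrite /demazure.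
have ba : b - a != 0 by rewrite -oppr_eq0 opprB.
have cb : c - b != 0 by rewrite -oppr_eq0 opprB.
rewrite !(fmorphV, rmorphB, rmorphM, ss, tt, sts, sa, sb, sc, ta, tb, tc).
by field; rewrite ?ab ?bc ?ac ?ba ?cb.
Qed.

End Demazure.

(** * Lehmer code and length *)

Section Code.
Variable n : nat.
Implicit Types (w : 'S_n) (i j x : 'I_n).

Definition code w i : nat := (\sum_(k < n) ((i < k) && (w k < w i)))%N.

Lemma perm_length_code w : perm_length w = (\sum_i code w i)%N.
Proof.
rewrite /perm_length -sum1dep_card big_mkcond /= pair_bigA /=.
by apply: eq_bigr => -[i j] _ /=; case: ifP.
Qed.

Lemma code_tpermE w i j x :
  code (tperm i j * w)%g x
    = (\sum_(k < n) ((x < tperm i j k) && (w k < w (tperm i j x))))%N.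
Proof.
rewrite /code (reindex_inj (@perm_inj _ (tperm i j))) /=.
by apply: eq_bigr => k _; rewrite !permM tpermK.
Qed.

(** At an ascent the exchange swaps the two code entries and adds the single new inversion to the
    left one. *)
Lemma code_tperm_l w i j : j = i.+1 :> nat -> (w i < w j)%N ->
  code (tperm i j * w)%g i = (code w j).+1.
Proof.
move=> ji lt_w; have lt_ij : (i < j)%N by rewrite ji.
rewrite code_tpermE tpermL /code -add1n.
rewrite (bigD1 i) //= [in RHS](bigD1 i) //= tpermL lt_w lt_ij.
rewrite [(j < i)%N]ltnNge (ltnW lt_ij) /= add0n.
congr (_ + _)%N; apply: eq_bigr => k neq_ki.
case: tpermP => [eq_ki|->|_ /eqP neq_kj]; first by rewrite eq_ki eqxx in neq_ki.
  by rewrite !ltnn andbF.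
congr (_ && _ : nat); move: neq_ki neq_kj; rewrite -!val_eqE /= ji.
by move: (k : nat) (i : nat) => x y; lia.
Qed.

Lemma code_tperm_r w i j : j = i.+1 :> nat -> (w i < w j)%N ->
  code (tperm i j * w)%g j = code w i.
Proof.
move=> ji lt_w; rewrite code_tpermE tpermR /code; apply: eq_bigr => k _.
case: tpermP => [->|->|/eqP neq_ki /eqP neq_kj].
- by rewrite !ltnn.
- by rewrite [(w j < _)%N]ltnNge (ltnW lt_w) !andbF.
congr (_ && _ : nat); move: neq_ki neq_kj; rewrite -!val_eqE /= ji.
by move: (k : nat) (i : nat) => y z; lia.
Qed.

Lemma code_tperm_other w i j x : j = i.+1 :> nat -> x != i -> x != j ->
  code (tperm i j * w)%g x = code w x.
Proof.
move=> ji xi xj; rewrite code_tpermE tpermD 1?eq_sym // /code.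
apply: eq_bigr => k _; congr (_ && _ : nat).
case: tpermP => [->|->|//]; move: xi xj; rewrite -!val_eqE /= ji;
  by move: (x : nat) (i : nat) => y z; lia.
Qed.

Lemma perm_length_tperm w i j : j = i.+1 :> nat -> (w i < w j)%N ->
  perm_length (tperm i j * w)%g = (perm_length w).+1.
Proof.
move=> ji lt_w; rewrite !perm_length_code.
have neq_ji : j != i by rewrite -val_eqE /= ji gtn_eqF.
rewrite (bigD1 i) // (bigD1 j) //= [in RHS](bigD1 i) // [in RHS](bigD1 j) //=.
rewrite code_tperm_l // code_tperm_r // addSn addnCA; congr (_.+1).
by congr (_ + (_ + _))%N; apply: eq_bigr => x /andP[xi xj]; rewrite code_tperm_other.
Qed.

(** At a descent the exchange would lower the length, so the length condition of [double_groth_step]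
    singles out the ascents. *)
Lemma perm_length_tpermP w i j : j = i.+1 :> nat ->
  perm_length (tperm i j * w)%g = (perm_length w).+1 -> (w i < w j)%N.
Proof.
move=> ji lenE; case: ltngtP => // [lt_w|/val_inj/perm_inj eq_ij].
  have := @perm_length_tperm (tperm i j * w)%g i j ji.
  rewrite !permM tpermL tpermR => /(_ lt_w).
  by rewrite mulgA tperm2 mul1g lenE => /eqP; rewrite ltn_eqF.
by move: ji; rewrite eq_ij => /eqP; rewrite ltn_eqF.
Qed.

End Code.

(** * Double Grothendieck polynomials are well defined *)

Section DoubleGrothendieckWellDefined.
Variables (F : fieldType) (n : nat).
Implicit Types (w : 'S_n) (i j k : 'I_n) (f g h : abfun F n).
Local Notation dg := (@double_groth F n).

Definition aswap i j : 'S_(n + n) := tperm (lshift n i) (lshift n j).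

Lemma pi_opE i j f :
  pi_op i j f = demazure (@sact F _ (aswap i j)) (avar F i) (avar F j) f.
Proof. by rewrite /demazure /= sact.unlock. Qed.

Lemma avar_neq i j : i != j -> avar F i != avar F j.
Proof.
apply: contraNneq => /eqP; rewrite tofrac_eq => /eqP /mpolyP /(_ U_(lshift n i)%MM).
rewrite !mcoeffX eqxx; case: eqP => [e _|_ e].
  move/mnmP/(_ (lshift n i)): e; rewrite !mnm1E eqxx.
  by case: eqP => // /lshift_inj ->.
by case/negP: (oner_neq0 F); apply/eqP.
Qed.

Lemma sact_avar (s : 'S_(n + n)) i j : s (lshift n i) = lshift n j ->
  sact s (avar F i) = avar F j.
Proof. by move=> si; rewrite /avar sactX si. Qed.

Lemma sact_aswapK i j f : sact (aswap i j) (sact (aswap i j) f) = f.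
Proof. by rewrite -sactM tperm2 sact1. Qed.

Lemma aswapL i j : aswap i j (lshift n i) = lshift n j.
Proof. exact: tpermL. Qed.
Lemma aswapR i j : aswap i j (lshift n j) = lshift n i.
Proof. exact: tpermR. Qed.
Lemma aswapD i j k : k != i -> k != j -> aswap i j (lshift n k) = lshift n k.
Proof. by move=> ki kj; rewrite /aswap tpermD // (inj_eq (@lshift_inj n n)) eq_sym. Qed.

Lemma tperm_comm (T : finType) (x y x' y' : T) :
  x != x' -> x != y' -> y != x' -> y != y' ->
  (tperm x y * tperm x' y' = tperm x' y' * tperm x y)%g.
Proof. by move=> *; rewrite conjgC tpermJ !tpermD 1?eq_sym. Qed.

Lemma tperm_braid (T : finType) (x y z : T) : x != y -> y != z -> x != z ->
  (tperm x y * (tperm y z * tperm x y) = tperm y z * (tperm x y * tperm y z))%g.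
Proof.
move=> xy yz xz.
have -> : (tperm x y * (tperm y z * tperm x y) = tperm y z ^ tperm x y)%g.
  by rewrite /conjg tpermV.
have -> : (tperm y z * (tperm x y * tperm y z) = tperm x y ^ tperm y z)%g.
  by rewrite /conjg tpermV.
by rewrite !tpermJ tpermR tpermL [tperm x y z]tpermD ?[tperm y z x]tpermD // eq_sym.
Qed.

Lemma pi_op_comm i j i' j' f : i != j -> i' != j' ->
  i != i' -> i != j' -> j != i' -> j != j' ->
  pi_op i j (pi_op i' j' f) = pi_op i' j' (pi_op i j f).
Proof.
move=> ij ij' ii' ij'' ji' jj'; rewrite !pi_opE; apply: demazure_comm; rewrite ?avar_neq //.
- move=> x; rewrite /= -!sactM; congr (sact _ _).
  by apply: tperm_comm; rewrite (inj_eq (@lshift_inj n n)) eq_sym.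
- by apply: sact_avar; rewrite aswapD // eq_sym.
- by apply: sact_avar; rewrite aswapD // eq_sym.
- by apply: sact_avar; rewrite aswapD.
- by apply: sact_avar; rewrite aswapD.
Qed.

Lemma pi_op_braid i j k f : i != j -> j != k -> i != k ->
  pi_op i j (pi_op j k (pi_op i j f)) = pi_op j k (pi_op i j (pi_op j k f)).
Proof.
move=> ij jk ik; rewrite !pi_opE; apply: demazure_braid; rewrite ?avar_neq //=.
- exact: sact_aswapK.
- exact: sact_aswapK.
- move=> x; rewrite -!sactM; congr (sact _ _).
  by apply: tperm_braid; rewrite (inj_eq (@lshift_inj n n)).
- by apply: sact_avar; rewrite aswapL.
- by apply: sact_avar; rewrite aswapR.
- by apply: sact_avar; rewrite aswapD // eq_sym.
- by apply: sact_avar; rewrite aswapD.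
- by apply: sact_avar; rewrite aswapL.
- by apply: sact_avar; rewrite aswapR.
Qed.

Lemma sact_pi_op i j f : sact (aswap i j) (pi_op i j f) = pi_op i j f.
Proof.
rewrite pi_opE; apply: demazure_sym; first exact: sact_aswapK.
  by apply: sact_avar; rewrite aswapL.
by apply: sact_avar; rewrite aswapR.
Qed.

Lemma perm_length_leq w : (perm_length w <= n * n)%N.
Proof. by apply: leq_trans (max_card _) _; rewrite card_prod card_ord. Qed.

Lemma longest_permE i : longest_perm n i = (n - i.+1)%N :> nat.
Proof. by rewrite permE. Qed.

(** Descent from the first position gives w x <= n - 1 - x; going backwards from the last position
    gives the opposite bound. *)
Lemma eq_longest_perm w :
  (forall i j, j = i.+1 :> nat -> (w j < w i)%N) -> w = longest_perm n.
Proof.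
move=> dec; apply/permP=> i; apply/val_inj; rewrite /= longest_permE.
have ub m (x : 'I_n) : x = m :> nat -> (w x + m < n)%N.
  elim: m x => [|m IHm] x xE; first by rewrite addn0 ltn_ord.
  have ltm : (m < n)%N by rewrite -ltnS -xE ltnW // ltnS ltn_ord.
  have := IHm (Ordinal ltm) erefl; have := dec (Ordinal ltm) x xE.
  by move: (w x : nat) (w (Ordinal ltm) : nat) => a b; lia.
have lb m (x : 'I_n) : (x + m.+1)%N = n -> (m <= w x)%N.
  elim: m x => [//|m IHm] x xE.
  have ltx : (x.+1 < n)%N by move: xE; lia.
  have := IHm (Ordinal ltx); have := dec x (Ordinal ltx) erefl.
  by move: xE => /=; move: (w x : nat) (w (Ordinal ltx) : nat) => a b; lia.
have := ub _ i erefl; have := lb (n - i.+1)%N i; have := ltn_ord i.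
by move: (i : nat) (w i : nat) => a b; lia.
Qed.

Lemma ascent_neq w : w != longest_perm n ->
  exists i j, j = i.+1 :> nat /\ (w i < w j)%N.
Proof.
move=> neq; have [/existsP[i /existsP[j /andP[/eqP ji lt_w]]]|noasc] :=
  boolP [exists i : 'I_n, exists j : 'I_n, (j == i.+1 :> nat) && (w i < w j)%N].
  by exists i, j.
case/negP: neq; apply/eqP/eq_longest_perm => i j ji.
rewrite ltn_neqAle leqNgt; apply/andP; split.
  by rewrite (inj_eq val_inj) (inj_eq perm_inj) -val_eqE /= ji gtn_eqF.
apply: contraNN noasc => lt_w; apply/existsP; exists i; apply/existsP; exists j.
by rewrite ji eqxx.
Qed.

Lemma double_groth_exists w : exists f, dg w f.
Proof.
have [d] := ubnP (n * n - perm_length w); elim: d w => // d IHd w ltd.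
have [->|/ascent_neq [i [j [ji lt_w]]]] := eqVneq w (longest_perm n).
  by eexists; apply: double_groth_longest.
have lenE := perm_length_tperm ji lt_w.
have [|f fP] := IHd (tperm i j * w)%g.
  by have := perm_length_leq (tperm i j * w)%g; move: ltd; rewrite lenE; lia.
by exists (pi_op i j f); apply: double_groth_step fP.
Qed.

Lemma double_grothP w f : dg w f ->
  (w = longest_perm n /\
    f = \prod_(i < n) \prod_(j < n | (i.+1 + j.+1 <= n)%N) (1 - bvar F i / avar F j))
  \/ exists i j g, [/\ j = i.+1 :> nat, (w i < w j)%N, dg (tperm i j * w)%g g
      & f = pi_op i j g].
Proof.
case=> [|{}w i j {}f ji lenE fP]; first by left.
by right; exists i, j, f; split=> //; apply: perm_length_tpermP lenE.
Qed.

Lemma double_groth_pi w i j f : j = i.+1 :> nat -> (w i < w j)%N ->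
  dg (tperm i j * w)%g f -> dg w (pi_op i j f).
Proof. by move=> ji lt_w; apply: double_groth_step ji (perm_length_tperm ji lt_w). Qed.

Lemma longest_perm_descent i j : j = i.+1 :> nat ->
  (longest_perm n j < longest_perm n i)%N.
Proof. by move=> ji; rewrite !longest_permE ji; have := ltn_ord j; rewrite ji; lia. Qed.

(** Two chains may start with different ascents of w. By induction each polynomial one step up can
    be computed along any chain, so both chains are led through a common permutation: two steps up
    for distant ascents, three for adjacent ones. There the commutation or braid relation
    applies. *)
Lemma double_groth_uniq w f g : dg w f -> dg w g -> f = g.
Proof.
have [d] := ubnP (n * n - perm_length w).
elim: d w f g => // d IHd w f g ltd.
have IH i j u v : j = i.+1 :> nat -> (w i < w j)%N ->
    dg (tperm i j * w)%g u -> dg (tperm i j * w)%g v -> u = v.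
  move=> ji lt_w; apply: IHd; have := perm_length_leq (tperm i j * w)%g.
  by move: ltd; rewrite (perm_length_tperm ji lt_w); lia.
case/double_grothP=> [[w0 ->]|[i [j [u [ji lt_ij uP ->]]]]].
  case/double_grothP=> [[_ ->//]|[i [j [v [ji]]]]].
  by rewrite w0 ltnNge ltnW // longest_perm_descent.
case/double_grothP=> [[w0]|[i' [j' [v [ji' lt_ij' vP ->]]]]].
  by move: lt_ij; rewrite w0 ltnNge ltnW // longest_perm_descent.
wlog le_ii' : i j i' j' u v ji lt_ij uP ji' lt_ij' vP / (i <= i')%N.
  move=> wl; have [le_ii'|/ltnW le_i'i] := leqP i i'; first exact: wl.
  by symmetry; apply: wl.
have neq (x y : 'I_n) : y = x.+1 :> nat -> x != y by move=> e; rewrite -val_eqE /= e ltn_eqF.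
move: le_ii'; rewrite leq_eqVlt => /predU1P[/val_inj eq_ii'|].
  have eq_jj' : j = j' by apply/val_inj; rewrite /= ji ji' eq_ii'.
  by congr pi_op => //; apply: (IH _ _ _ _ ji lt_ij uP); rewrite eq_ii' eq_jj'.
rewrite leq_eqVlt => /predU1P[eq_ji'|lt_ji'].
  have eq_j : i' = j by apply/val_inj; rewrite /= -eq_ji' ji.
  subst i'.
  have ij := neq _ _ ji; have jk := neq _ _ ji'.
  have ik : i != j' by rewrite -val_eqE /= ji' ji ltn_eqF.
  (* The values of w at i, j, j' increase; both reduced words of their reversal lead up from w to
     this permutation. *)
  have [h hP] := double_groth_exists (tperm i j * (tperm j j' * (tperm i j * w)))%g.
  have -> : u = pi_op j j' (pi_op i j h).
    apply: (IH _ _ _ _ ji lt_ij uP); apply: double_groth_pi => //.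
      by rewrite !permM tpermR [tperm i j j']tpermD // (ltn_trans lt_ij).
    apply: double_groth_pi hP => //; rewrite !permM.
    by rewrite [tperm j j' i]tpermD 1?eq_sym // tpermL [tperm j j' j]tpermL [tperm i j j']tpermD.
  have -> : v = pi_op i j (pi_op j j' h).
    apply: (IH _ _ _ _ ji' lt_ij' vP); apply: double_groth_pi => //.
      by rewrite !permM tpermL [tperm j j' i]tpermD 1?eq_sym // (ltn_trans lt_ij).
    apply: double_groth_pi => //.
      rewrite !permM [tperm i j j']tpermD // [tperm i j j]tpermR tpermR.
      by rewrite [tperm j j' i]tpermD 1?eq_sym.
    have := tperm_braid ij jk ik; rewrite !mulgA => <-.
    by rewrite !mulgA in hP.
  exact: pi_op_braid.
have far (x y : 'I_n) : (x < y)%N -> x != y by move=> e; rewrite -val_eqE /= ltn_eqF.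
have [ij ij'] := (neq _ _ ji, neq _ _ ji').
have ii' : i != i' by apply: far; lia.
have ij'' : i != j' by apply: far; lia.
have ji'' : j != i' by apply: far; lia.
have jj' : j != j' by apply: far; lia.
have [h hP] := double_groth_exists (tperm i j * (tperm i' j' * w))%g.
have -> : u = pi_op i' j' h.
  apply: (IH _ _ _ _ ji lt_ij uP); apply: double_groth_pi => //.
    by rewrite !permM !tpermD.
  by rewrite mulgA -tperm_comm // -mulgA.
have -> : v = pi_op i j h.
  apply: (IH _ _ _ _ ji' lt_ij' vP); apply: double_groth_pi => //.
  by rewrite !permM !tpermD // eq_sym.
exact: pi_op_comm.
Qed.

End DoubleGrothendieckWellDefined.

(** * Dominant permutations *)

Section Dominant.
Variables (F : fieldType) (n : nat).
Implicit Types (w : 'S_n) (i j k x : 'I_n) (f g h : abfun F n).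

Lemma sum_gt_ord (x : nat) : (\sum_(k < n) (x < k) = n - x.+1)%N.
Proof.
elim: n => [|m IHm]; first by rewrite big_ord0.
by rewrite big_ord_recr /= IHm; case: ltnP => /=; lia.
Qed.

Lemma sum_lt_ord (x : nat) : (x <= n)%N -> (\sum_(k < n) (k < x) = x)%N.
Proof.
elim: n => [|m IHm] in x *; first by rewrite big_ord0 leqn0 => /eqP.
rewrite big_ord_recr /=; case: (ltnP m x) => [lt_mx le_xm|le_xm _]; last by rewrite IHm ?addn0.
have -> : x = m.+1 by lia.
by rewrite (eq_bigr (fun _ => 1%N)) => [|i _]; rewrite ?sum_nat_const ?card_ord ?muln1 ?addn1 // ltnS ltnW.
Qed.

Lemma code_leq w i : (code w i <= n - i.+1)%N.
Proof. by rewrite -sum_gt_ord; apply: leq_sum => k _; case: (_ < _)%N; rewrite ?leq_b1. Qed.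

Lemma code_ltn w i : (code w i < n)%N.
Proof. by apply: leq_ltn_trans (code_leq w i) _; have := ltn_ord i; lia. Qed.

Lemma code_longest i : code (longest_perm n) i = (n - i.+1)%N.
Proof.
rewrite -sum_gt_ord; apply: eq_bigr => k _; rewrite !longest_permE.
by case: ltnP => //= lt_ik; rewrite (_ : (_ < _)%N) //; have := ltn_ord k; lia.
Qed.

Lemma code_ascent w i j : j = i.+1 :> nat -> (w i < w j)%N -> (code w i <= code w j)%N.
Proof.
move=> ji lt_w; apply: leq_sum => k _.
have [->|neq_kj] := eqVneq k j; first by rewrite [(w j < w i)%N]ltnNge (ltnW lt_w) andbF.
have -> : (i < k)%N = (j < k)%N.
  by move: neq_kj; rewrite -val_eqE /= ji; move: (k : nat) (i : nat) => a b; lia.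
by case: (j < k)%N => //=; case: ltnP => //= lt_ki; rewrite (ltn_trans lt_ki).
Qed.

Lemma code_descent w i j : j = i.+1 :> nat -> (w j < w i)%N -> (code w j < code w i)%N.
Proof.
move=> ji lt_w; pose v := (tperm i j * w)%g.
have wE : w = (tperm i j * v)%g by rewrite mulgA tperm2 mul1g.
have lt_v : (v i < v j)%N by rewrite !permM tpermL tpermR.
by rewrite wE code_tperm_l // code_tperm_r // ltnS code_ascent.
Qed.

(** Equivalently, w avoids the pattern 132. *)
Definition dominant w := forall i j, (i <= j)%N -> (code w j <= code w i)%N.

(** Take the first ascent i. Its two code entries are equal, by dominance and [code_ascent], while
    descents make the code strictly larger before i; hence raising the entry at i by one keeps the
    code decreasing. *)
Lemma dominant_step w : dominant w -> w != longest_perm n ->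
  exists i j, [/\ j = i.+1 :> nat, (w i < w j)%N, code w i = code w j
    & dominant (tperm i j * w)%g].
Proof.
move=> dom /ascent_neq [i1 [j1 [ji1 lt_w1]]].
pose P i := [exists j : 'I_n, (j == i.+1 :> nat) && (w i < w j)%N].
have P1 : P i1 by apply/existsP; exists j1; rewrite ji1 eqxx.
case: (@arg_minnP _ i1 P (@nat_of_ord n) P1) => i /existsP[j /andP[/eqP ji lt_w]] min_i.
have eq_c : code w i = code w j.
  by apply/eqP; rewrite eqn_leq code_ascent // dom // ji.
exists i, j; split=> // a b le_ab.
have before x : (x < i)%N -> (code w i < code w x)%N.
  move=> lt_xi; have ltp : (i.-1 < n)%N by apply: leq_ltn_trans (leq_pred _) (ltn_ord i).
  pose p := Ordinal ltp.
  have ip : i = p.+1 :> nat by rewrite /= (ltn_predK lt_xi).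
  apply: (@leq_trans (code w p)); last by apply: dom; rewrite /= -ltnS (ltn_predK lt_xi).
  apply: code_descent => //; rewrite ltnNge; apply/negP => le_pi.
  have : (i <= p)%N.
    apply: min_i; apply/existsP; exists i; rewrite ip eqxx /= ltn_neqAle le_pi andbT.
    by rewrite (inj_eq val_inj) (inj_eq perm_inj) -val_eqE /= ltn_eqF // ltn_predL (leq_ltn_trans _ lt_xi).
  by rewrite ip ltnn.
have cE x : code (tperm i j * w)%g x = (code w x + (x == i))%N.
  have [->|neq_xi] := eqVneq x i; first by rewrite code_tperm_l // -eq_c addn1.
  have [->|neq_xj] := eqVneq x j; first by rewrite code_tperm_r // eq_c addn0.
  by rewrite code_tperm_other // addn0.
rewrite !cE; have [eb|neq_b] := eqVneq b i; last by rewrite addn0 (leq_trans (dom _ _ le_ab)) ?leq_addr.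
have [ea|neq_a] := eqVneq a i; first by rewrite ea eb.
rewrite addn0 eb addn1; apply: before; rewrite ltn_neqAle -eb le_ab andbT.
by rewrite val_eqE eb.
Qed.

End Dominant.

(** * Action on the alpha variables and dominant Grothendieck polynomials *)

Section AlphaAction.
Variables (F : fieldType) (n : nat).
Implicit Types (w : 'S_n) (s : 'S_n) (i j k x y : 'I_n) (f g h : abfun F n).
Local Notation dg := (@double_groth F n).
Local Notation av := (@avar F n).
Local Notation bv := (@bvar F n).

Definition alpha_perm_fun s (x : 'I_(n + n)) : 'I_(n + n) :=
  match split x with inl i => lshift n (s i) | inr i => rshift n i end.

Lemma alpha_perm_fun_inj s : injective (alpha_perm_fun s).
Proof.
move=> x y; rewrite /alpha_perm_fun.
case: (split_ordP x) => i ->; case: (split_ordP y) => j -> /eqP.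
- by rewrite (inj_eq (@lshift_inj _ _)) (inj_eq perm_inj) => /eqP->.
- by rewrite eq_lrshift.
- by rewrite eq_rlshift.
- by move/eqP.
Qed.

Definition alpha_perm s : 'S_(n + n) := perm (@alpha_perm_fun_inj s).

Lemma alpha_perm_lshift s i : alpha_perm s (lshift n i) = lshift n (s i).
Proof.
rewrite permE /alpha_perm_fun; case: (split_ordP (lshift n i)) => [j /lshift_inj <- //|j /eqP].
by rewrite eq_lrshift.
Qed.

Lemma alpha_perm_rshift s i : alpha_perm s (rshift n i) = rshift n i.
Proof.
rewrite permE /alpha_perm_fun; case: (split_ordP (rshift n i)) => [j /eqP|j -> //].
by rewrite eq_rlshift.
Qed.

Lemma alpha_permM s t : alpha_perm (s * t)%g = (alpha_perm s * alpha_perm t)%g.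
Proof.
apply/permP => x; case: (split_ordP x) => i ->; rewrite permM.
  by rewrite !alpha_perm_lshift permM.
by rewrite !alpha_perm_rshift.
Qed.

Lemma alpha_perm_tperm i j : alpha_perm (tperm i j) = aswap i j.
Proof.
apply/permP => x; case: (split_ordP x) => k ->; rewrite /aswap.
  rewrite alpha_perm_lshift; case: tpermP => [->|->|/eqP ki /eqP kj]; rewrite ?tpermL ?tpermR //.
  by rewrite tpermD // (inj_eq (@lshift_inj _ _)) eq_sym.
by rewrite alpha_perm_rshift tpermD // eq_lrshift.
Qed.

Definition aact s f : abfun F n := sact (alpha_perm s) f.

HB.instance Definition _ s := GRing.RMorphism.copy (aact s) (@sact F _ (alpha_perm s)).

Lemma aactM s t f : aact (s * t)%g f = aact t (aact s f).
Proof. by rewrite /aact alpha_permM sactM. Qed.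

Lemma aact_avar s i : aact s (av i) = av (s i).
Proof. by rewrite /aact /avar sactX alpha_perm_lshift. Qed.

Lemma aact_bvar s i : aact s (bv i) = bv i.
Proof. by rewrite /aact /bvar sactX alpha_perm_rshift. Qed.

Lemma pi_op_aact i j f : pi_op i j f = demazure (aact (tperm i j)) (av i) (av j) f.
Proof. by rewrite pi_opE /demazure /= /aact alpha_perm_tperm. Qed.

Lemma aact_pi_op i j f : aact (tperm i j) (pi_op i j f) = pi_op i j f.
Proof. by rewrite /aact alpha_perm_tperm sact_pi_op. Qed.

Lemma avar_neq0 i : av i != 0.
Proof.
rewrite /avar tofrac_eq0; apply/eqP => /mpolyP /(_ U_(lshift n i)%MM).
by rewrite mcoeffX eqxx mcoeff0 => /eqP; rewrite oner_eq0.
Qed.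

(** Contribution of a row of length c in the diagram of a dominant permutation. *)
Definition row_factor (c : nat) x : abfun F n :=
  \prod_(k < n | (k < c)%N) (1 - bv k / av x).

Lemma aact_row_factor s c x : aact s (row_factor c x) = row_factor c (s x).
Proof.
rewrite /row_factor rmorph_prod; apply: eq_bigr => k _.
by rewrite rmorphB rmorph1 fmorph_div /= aact_bvar aact_avar.
Qed.

Lemma row_factorS c x (lt_cn : (c < n)%N) :
  row_factor c.+1 x = (1 - bv (Ordinal lt_cn) / av x) * row_factor c x.
Proof.
rewrite /row_factor (bigD1 (Ordinal lt_cn)) //=; congr (_ * _); apply: eq_bigl => k.
by rewrite -val_eqE /= ltnS andbC -ltn_neqAle.
Qed.

Lemma demazure_one_minus (L : fieldType) (s : {rmorphism L -> L}) (a b c : L) :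
  a != 0 -> b != 0 -> a != b -> s a = b -> s c = c -> demazure s a b (1 - c / a) = 1.
Proof.
rewrite -[a == b]subr_eq0 => a0 b0 ab sa sc.
rewrite /demazure rmorphB rmorph1 fmorph_div sa sc.
by field; rewrite a0 b0 ab.
Qed.

(** One dominant step up, the product gains a single factor 1 - b / alpha_i. The rest is symmetric
    in alpha_i and alpha_j, since the two code entries agree, so it passes through the operator,
    which sends 1 - b / alpha_i to 1. *)
Lemma double_groth_dominant w : dominant w -> dg w (\prod_x row_factor (code w x) x).
Proof.
have [d] := ubnP (n * n - perm_length w); elim: d w => // d IHd w ltd dom.
have [->|neq_w] := eqVneq w (longest_perm n).
  have -> : \prod_x row_factor (code (longest_perm n) x) x
      = \prod_(i < n) \prod_(j < n | (i.+1 + j.+1 <= n)%N) (1 - bv i / av j).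
    rewrite [RHS](exchange_big_dep xpredT) //=; apply: eq_bigr => x _.
    apply: eq_bigl => k; rewrite code_longest.
    by move: (ltn_ord x) (ltn_ord k); move: (x : nat) (k : nat) => a b; lia.
  exact: double_groth_longest.
have [i [j [ji lt_w eq_c dom']]] := dominant_step dom neq_w.
have ltc := code_ltn w i.
have neq_ij : i != j by rewrite -val_eqE /= ji ltn_eqF.
have -> : \prod_x row_factor (code w x) x
        = pi_op i j (\prod_x row_factor (code (tperm i j * w)%g x) x).
  set S := \prod_x row_factor (code w x) x.
  have -> : \prod_x row_factor (code (tperm i j * w)%g x) x
          = S * (1 - bv (Ordinal ltc) / av i).
    rewrite /S (bigD1 i) //= [X in _ = X * _](bigD1 i) //= code_tperm_l // -eq_c.
    rewrite (row_factorS _ ltc) mulrC [RHS]mulrC mulrA [X in X * _]mulrC -!mulrA.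
    congr (_ * _); rewrite [RHS]mulrC; congr (_ * _).
    apply: eq_bigr => x neq_xi; congr row_factor.
    have [->|neq_xj] := eqVneq x j; first by rewrite code_tperm_r.
    by rewrite code_tperm_other.
  have symS : aact (tperm i j) S = S.
    rewrite /S rmorph_prod [RHS](reindex_inj (@perm_inj _ (tperm i j))) /=.
    apply: eq_bigr => x _; rewrite aact_row_factor; congr row_factor.
    by case: tpermP => [->|->|].
  rewrite pi_op_aact demazure_mul // demazure_one_minus ?mulr1 ?avar_neq0 ?avar_neq //.
    by rewrite /= aact_avar tpermL.
  by rewrite /= aact_bvar.
apply: double_groth_pi => //; apply: IHd => //.
have := perm_length_leq (tperm i j * w)%g; move: ltd; rewrite perm_length_tperm //.
by lia.
Qed.

End AlphaAction.

(** * Bialternant formula for Grassmannian permutations *)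

(** With D = (f - s f) / (a - b), which s fixes, the difference is b D and its image under s is a D;
    the hypothesis on m makes up for the change from b to a. *)
Lemma swap_invariant_difference (L : fieldType) (s : {rmorphism L -> L}) (a b m f : L) :
  a != b -> (forall x, s (s x) = x) -> s a = b -> s b = a -> a * s m = b * m ->
  s (m * (demazure s a b f - f)) = m * (demazure s a b f - f).
Proof.
rewrite -[a == b]subr_eq0 => ab ss sa sb sm.
rewrite rmorphM rmorphB /= demazure_sym // /demazure.
have -> : (a * f - b * s f) / (a - b) - s f = a * ((f - s f) / (a - b)) by field.
have -> : (a * f - b * s f) / (a - b) - f = b * ((f - s f) / (a - b)) by field.
by rewrite mulrA [s m * a]mulrC sm -mulrA mulrCA.
Qed.

Lemma inverse_power_swap (L : fieldType) (a b c : L) d : a != 0 -> b != 0 ->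
  a * (b^-1 ^+ d * (a^-1 ^+ d.+1 * c)) = b * (a^-1 ^+ d * (b^-1 ^+ d.+1 * c)).
Proof.
move=> a0 b0; rewrite !exprS; move: (a^-1 ^+ d) (b^-1 ^+ d) => A B.
by field; rewrite a0 b0.
Qed.

Section Alternation.
Variables (F : fieldType) (n P : nat).
Implicit Types (w : 'S_n) (s t : 'S_n) (i j k x y : 'I_n) (f g h u : abfun F n).
Local Notation av := (@avar F n).

Definition first_perm s := perm_on [set x : 'I_n | (x < P)%N] s.

Lemma first_perm_tperm i j : (i < P)%N -> (j < P)%N -> first_perm (tperm i j).
Proof.
move=> iP jP; apply/subsetP => x; rewrite !inE.
by case: tpermP => [->|->|]; rewrite ?eqxx.
Qed.

Lemma first_permM s t : first_perm s -> first_perm t -> first_perm (s * t)%g.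
Proof. exact: perm_onM. Qed.

Definition alternant f : abfun F n := \sum_(s | first_perm s) (-1) ^+ s * aact s f.

Lemma alternantB f g : alternant (f - g) = alternant f - alternant g.
Proof.
by rewrite /alternant -sumrB; apply: eq_bigr => s _; rewrite rmorphB mulrBr.
Qed.

(** Even terms are cancelled against odd ones instead of deducing x = - x, so characteristic 2 is
    covered. *)
Lemma alternant_eq0 i j u : (i < P)%N -> (j < P)%N -> i != j ->
  aact (tperm i j) u = u -> alternant u = 0.
Proof.
move=> iP jP neq_ij tu; set t := tperm i j in tu.
have tP : first_perm t by apply: first_perm_tperm.
rewrite /alternant (bigID (fun s : 'S_n => odd_perm s)) /=.
rewrite (reindex_inj (mulgI t)) /= -[X in _ + X]opprK; apply/eqP; rewrite subr_eq0; apply/eqP.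
rewrite -sumrN; apply: eq_big => [s|s _].
  rewrite odd_permM odd_tperm neq_ij addTb; congr (_ && _).
  apply/idP/idP => [tsP|]; last exact: first_permM.
  by rewrite -[s]mul1g -(tperm2 i j) -mulgA first_permM.
by rewrite odd_permM odd_tperm neq_ij signr_addb aactM tu expr1 !mulN1r mulNr.
Qed.

Lemma alternantM u g : (forall s, first_perm s -> aact s u = u) ->
  alternant (u * g) = u * alternant g.
Proof.
move=> inv; rewrite /alternant mulr_sumr; apply: eq_bigr => s sP.
by rewrite rmorphM /= inv // mulrCA.
Qed.

Lemma adjacent_invariant u :
  (forall i j, j = i.+1 :> nat -> (j < P)%N -> aact (tperm i j) u = u) ->
  forall s, first_perm s -> aact s u = u.
Proof.
move=> adj.
have dist d i j : j = (i + d.+1)%N :> nat -> (j < P)%N -> aact (tperm i j) u = u.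
  elim: d i j => [|d IHd] i j ji jP; first by apply: adj; rewrite // ji addn1.
  have ltm : (i + d.+1 < n)%N by apply: leq_ltn_trans (ltn_ord j); rewrite ji; lia.
  pose m := Ordinal ltm.
  have mP : (m < P)%N by apply: leq_ltn_trans jP; rewrite /= ji; lia.
  have im : i != m by rewrite -val_eqE /=; lia.
  have ij : i != j by rewrite -val_eqE /= ji; lia.
  have -> : tperm i j = (tperm m j * (tperm i m * tperm m j))%g.
    have -> : (tperm m j * (tperm i m * tperm m j) = tperm i m ^ tperm m j)%g.
      by rewrite /conjg tpermV.
    by rewrite tpermJ tpermL tpermD // eq_sym.
  have mj : aact (tperm m j) u = u by apply: adj => //; rewrite /= ji addnS.
  by rewrite !aactM mj IHd.
have anyt i j : i != j -> (i < P)%N -> (j < P)%N -> aact (tperm i j) u = u.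
  move=> neq_ij iP jP; wlog lt_ij : i j neq_ij iP jP / (i < j)%N.
    move=> wl; case: (ltngtP i j) => [lt|lt|e]; first exact: wl.
      by rewrite tpermC wl // eq_sym.
    by move: neq_ij; rewrite -val_eqE /= e eqxx.
  by apply: (dist (j - i.+1)%N) => //; lia.
move=> s; have [d] := ubnP #|[set x | s x != x]|; elim: d s => // d IHd s ltd sP.
case: (pickP [pred x | s x != x]) => [x /= sx|fix_s]; last first.
  have -> : s = 1%g by apply/permP => x; rewrite perm1; have := fix_s x => /= /negbFE/eqP.
  by rewrite /aact (_ : alpha_perm 1 = 1%g) ?sact1 //; apply: (@mulgI _ (alpha_perm 1));
     rewrite -alpha_permM !mulg1.
(* s followed by t fixes x and every point fixed by s, so fewer points move. *)
pose t := tperm x (s x).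
have xP : (x < P)%N by have /subsetP/(_ x) := sP; rewrite !inE => ->.
have sxP : (s x < P)%N.
  by have /subsetP/(_ (s x)) := sP; rewrite !inE (inj_eq perm_inj) => ->.
have tP : first_perm t by apply: first_perm_tperm.
have -> : s = ((s * t) * t)%g by rewrite -mulgA tperm2 mulg1.
rewrite aactM IHd ?anyt ?first_permM 1?eq_sym //.
rewrite -ltnS; apply: leq_trans ltd; rewrite ltnS; apply: proper_card.
apply/properP; split; last first.
  by exists x; rewrite !inE ?sx // permM /t tpermR eqxx.
apply/subsetP => y; rewrite !inE permM; apply: contraNN => /eqP sy.
rewrite sy /t tpermD //; last first.
  by apply: contraNneq sx => e; rewrite -(inj_eq (@perm_inj _ s)) e sy.
by apply: contraNneq sx => ->; rewrite sy.
Qed.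

(** Diagonal monomial of the Vandermonde determinant in the 1 / alpha_x; neighbouring exponents
    differ by one, which is what [weight_swap] needs. *)
Definition weight : abfun F n := \prod_(x < n | (x < P)%N) (av x)^-1 ^+ x.

Lemma weight_swap i j : j = i.+1 :> nat -> (j < P)%N ->
  av i * aact (tperm i j) weight = av j * weight.
Proof.
move=> ji jP; have iP : (i < P)%N by apply: leq_ltn_trans jP; rewrite ji.
have neq_ji : j != i by rewrite -val_eqE /= ji gtn_eqF.
have jiP : (j < P)%N && (j != i) by rewrite jP.
pose S : abfun F n := \prod_(x < n | ((x < P)%N && (x != i)) && (x != j)) (av x)^-1 ^+ x.
have -> : weight = (av i)^-1 ^+ i * ((av j)^-1 ^+ j * S).
  by rewrite /weight (bigD1 i) //= (bigD1 j).
have -> : aact (tperm i j) ((av i)^-1 ^+ i * ((av j)^-1 ^+ j * S))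
        = (av j)^-1 ^+ i * ((av i)^-1 ^+ j * S).
  rewrite !rmorphM !rmorphXn !fmorphV /= !aact_avar tpermL tpermR; congr (_ * (_ * _)).
  rewrite /S rmorph_prod; apply: eq_bigr => x /andP[/andP[_ xi] xj].
  by rewrite rmorphXn fmorphV /= aact_avar tpermD // eq_sym.
by rewrite ji; apply: inverse_power_swap; apply: avar_neq0.
Qed.

(* [weight * (pi_op i j f - f)] is invariant under the exchange of the two
   variables, so its alternant vanishes. *)
Lemma alternant_pi_op i j f : j = i.+1 :> nat -> (j < P)%N ->
  alternant (weight * pi_op i j f) = alternant (weight * f).
Proof.
move=> ji jP; have iP : (i < P)%N by apply: leq_ltn_trans jP; rewrite ji.
have neq_ij : i != j by rewrite -val_eqE /= ji ltn_eqF.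
apply/eqP; rewrite -subr_eq0 -alternantB -mulrBr; apply/eqP.
apply: (alternant_eq0 iP jP neq_ij); rewrite pi_op_aact.
apply: swap_invariant_difference; rewrite ?avar_neq //=.
- by move=> x; rewrite -aactM tperm2 /aact (_ : alpha_perm 1 = 1%g) ?sact1 //;
     apply: (@mulgI _ (alpha_perm 1)); rewrite -alpha_permM !mulg1.
- by rewrite aact_avar tpermL.
- by rewrite aact_avar tpermR.
- exact: weight_swap.
Qed.

End Alternation.

Section Bialternant.
Variables (F : fieldType) (n P : nat).
Implicit Types (w s u : 'S_n) (i j k x y : 'I_n) (f g h : abfun F n).
Local Notation dg := (@double_groth F n).
Local Notation alternant := (@alternant F n P).
Local Notation weight := (@weight F n P).

Lemma increasing_ge s : (forall x, (P <= x)%N -> s x = x) ->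
  (forall x y, (x < y)%N -> (y < P)%N -> (s x < s y)%N) -> forall x, (x <= s x)%N.
Proof.
move=> fix_s inc x; have [Px|xP] := leqP P x; first by rewrite fix_s.
case: x xP => m ltm /=; elim: m ltm => // m IHm ltm xP.
have ltm' : (m < n)%N by apply: ltnW.
exact: leq_ltn_trans (IHm ltm' (ltnW xP)) (inc (Ordinal ltm') (Ordinal ltm) (ltnSn m) xP).
Qed.

(** The quotient of the two permutations is increasing on the first P positions and fixes the
    others, so it moves no point down; neither does its inverse. *)
Lemma decreasing_uniq w u : (forall x, (P <= x)%N -> w x = u x) ->
  (forall x y, (x < y)%N -> (y < P)%N -> (w y < w x)%N) ->
  (forall x y, (x < y)%N -> (y < P)%N -> (u y < u x)%N) -> w = u.
Proof.
move=> eq_wu.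
have ge (a b : 'S_n) : (forall x, (P <= x)%N -> a x = b x) ->
    (forall x y, (x < y)%N -> (y < P)%N -> (a y < a x)%N) ->
    (forall x y, (x < y)%N -> (y < P)%N -> (b y < b x)%N) ->
    forall x, (x <= (a * b^-1)%g x)%N.
  move=> eq_ab deca decb; set s := (a * b^-1)%g.
  have fix_s x : (P <= x)%N -> s x = x by move=> Px; rewrite permM eq_ab // permK.
  have sP x : (x < P)%N -> (s x < P)%N.
    by rewrite !ltnNge; apply: contraNN => Psx; rewrite -(perm_inj (fix_s _ Psx)).
  have bs x : b (s x) = a x by rewrite permM permKV.
  apply: increasing_ge => // x y lt_xy yP; rewrite ltnNge; apply/negP => le_s.
  have := deca x y lt_xy yP; rewrite -!bs ltnNge => /negP; apply.
  move: le_s; rewrite leq_eqVlt => /predU1P[/val_inj->//|lt_s].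
  by apply/ltnW/decb => //; apply: sP; apply: ltn_trans yP.
move=> decw decu; apply/permP => x; apply: (@perm_inj _ u^-1); rewrite permK.
apply/val_inj/eqP; rewrite /= eqn_leq -permM ge // andbT.
have := ge u w (fun x Px => esym (eq_wu x Px)) decu decw ((w * u^-1)%g x).
by rewrite -permM mulgA mulgKV mulgV perm1.
Qed.

(** Exchanging ascents among the first P positions sorts w into u, and each exchange undoes one
    [pi_op], which the alternant does not see. *)
Lemma alternant_double_groth w u f g :
  (forall x, (P <= x)%N -> w x = u x) ->
  (forall x y, (x < y)%N -> (y < P)%N -> (u y < u x)%N) ->
  dg w f -> dg u g -> alternant (weight * f) = alternant (weight * g).
Proof.
have [d] := ubnP (n * n - perm_length w); elim: d w f => // d IHd w f ltd eq_wu decu fP gP.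
have [/existsP[i /existsP[j /and3P[/eqP ji jP lt_w]]]|noasc] :=
  boolP [exists i : 'I_n, exists j : 'I_n, [&& j == i.+1 :> nat, (j < P)%N & (w i < w j)%N]].
  have [h hP] := double_groth_exists F (tperm i j * w)%g.
  rewrite (double_groth_uniq fP (double_groth_pi ji lt_w hP)) alternant_pi_op //.
  apply: IHd hP gP => // [|x Px].
    have := perm_length_leq (tperm i j * w)%g; move: ltd; rewrite perm_length_tperm //.
    by lia.
  have neq y : (y < P)%N -> y != x.
    by move=> yP; apply: contraTneq Px => <-; rewrite -ltnNge.
  by rewrite permM tpermD ?eq_wu // neq // ltnW // -ji.
suff eq_w : w = u by rewrite eq_w in fP; rewrite (double_groth_uniq fP gP).
apply: decreasing_uniq => // x y; case: y => y lty /=; elim: y lty => // y IHy lty.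
have lty' : (y < n)%N by apply: ltnW.
rewrite ltnS => le_xy yP.
have desc : (w (Ordinal lty) < w (Ordinal lty'))%N.
  rewrite ltn_neqAle leqNgt; apply/andP; split.
    by rewrite (inj_eq val_inj) (inj_eq perm_inj) -val_eqE /= gtn_eqF.
  apply: contraNN noasc => lt_w; apply/existsP; exists (Ordinal lty'); apply/existsP.
  by exists (Ordinal lty); rewrite eqxx yP lt_w.
move: le_xy; rewrite leq_eqVlt => /predU1P[eq_xy|lt_xy].
  by rewrite (_ : x = Ordinal lty') //; apply/val_inj.
exact: ltn_trans desc (IHy lty' lt_xy (ltnW yP)).
Qed.

(** A permutation moving some x >= P meets a zero of the identity block, so the Leibniz sum reduces
    to the permutations of the first P indices. *)
Lemma alternant_det (e : 'I_n -> 'I_n -> abfun F n) :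
  (forall s i j, aact s (e i j) = e (s i) j) ->
  alternant (\prod_(x < n | (x < P)%N) e x x)
    = \det (\matrix_(i, j) if (j < P)%N then if (i < P)%N then e i j else 0
                           else (i == j)%:R).
Proof.
move=> eE; rewrite -det_tr /determinant /alternant big_mkcond; apply: eq_bigr => s _.
case: ifPn => [sP|nsP].
  congr (_ * _); rewrite rmorph_prod big_mkcond; apply: eq_bigr => x _; rewrite !mxE.
  have [xP|Px] := ltnP x P.
    have := perm_closed x sP; rewrite !inE xP => ->.
    by rewrite /= eE.
  by rewrite (out_perm sP) ?inE -?leqNgt // eqxx.
have [x Px sx] : exists2 x : 'I_n, (P <= x)%N & s x != x.
  by move: nsP; rewrite /first_perm /perm_on => /subsetPn[x]; rewrite !inE -leqNgt => sx Px; exists x.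
rewrite (bigD1 x) //= !mxE [(x < P)%N]ltnNge Px /= (negPf sx).
by rewrite mul0r mulr0.
Qed.

End Bialternant.

Section Grassmannian.
Variables (F : fieldType) (n P : nat).
Hypothesis le_Pn : (P <= n)%N.
Implicit Types (w s u : 'S_n) (i j k x y : 'I_n) (f g h : abfun F n).
Local Notation dg := (@double_groth F n).
Local Notation av := (@avar F n).
Local Notation alternant := (@alternant F n P).
Local Notation weight := (@weight F n P).

Lemma increasing_of_adjacent (lo hi : nat) w :
  (forall i j, j = i.+1 :> nat -> (lo <= i)%N -> (j < hi)%N -> (w i < w j)%N) ->
  forall x y, (lo <= x)%N -> (x < y)%N -> (y < hi)%N -> (w x < w y)%N.
Proof.
move=> adj x [y lty] /= lo_x; elim: y lty => // y IHy lty; rewrite ltnS => le_xy lt_yhi.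
have lty' : (y < n)%N by apply: ltnW.
have step : (w (Ordinal lty') < w (Ordinal lty))%N.
  by apply: adj => //; apply: leq_trans le_xy.
move: le_xy; rewrite leq_eqVlt => /predU1P[eq_xy|lt_xy].
  by rewrite (_ : x = Ordinal lty') //; apply/val_inj.
exact: ltn_trans (IHy lty' lt_xy (ltnW lt_yhi)) step.
Qed.

(** Reversing the first P values of a Grassmannian permutation makes them decrease while the others
    still increase; the result is dominant. *)
Definition rev_first x : 'I_n := if (x < P)%N then insubd x (P - x.+1)%N else x.

Lemma rev_firstE x : (x < P)%N -> rev_first x = (P - x.+1)%N :> nat.
Proof.
move=> xP; rewrite /rev_first xP val_insubd ifT //.
by apply: leq_trans le_Pn; lia.
Qed.

Lemma rev_first_id x : (P <= x)%N -> rev_first x = x.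
Proof. by rewrite /rev_first ltnNge => ->. Qed.

Lemma rev_firstK : involutive rev_first.
Proof.
move=> x; have [Px|xP] := leqP P x; first by rewrite !rev_first_id ?rev_first_id.
apply/val_inj; rewrite /= !rev_firstE ?rev_firstE //; lia.
Qed.

Definition rev_first_perm : 'S_n := perm (inv_inj rev_firstK).

(** For x < P all earlier values are larger, so every value below u x lies to the right. *)
Lemma code_dominant_shape u :
  (forall x y, (x < y)%N -> (y < P)%N -> (u y < u x)%N) ->
  (forall x y, (P <= x)%N -> (x < y)%N -> (u x < u y)%N) ->
  forall x, code u x = if (x < P)%N then u x : nat else 0%N.
Proof.
move=> dec inc x; rewrite /code; have [xP|Px] := ltnP x P; last first.
  rewrite big1 // => k _; case: ltnP => //= lt_xk.
  by rewrite ltnNge ltnW // inc.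
rewrite -[RHS](sum_lt_ord (ltnW (ltn_ord (u x)))).
rewrite [RHS](reindex_inj (@perm_inj _ u)) /=; apply: eq_bigr => k _.
case: (ltngtP x k) => // [lt_kx|/val_inj->]; last by rewrite ltnn.
by rewrite ltnNge ltnW // dec.
Qed.

Definition power_entry i j : abfun F n := (av i)^-1 ^+ j.
Definition shape_entry (v : nat -> nat) i j : abfun F n :=
  (av i)^-1 ^+ j * row_factor F (v j) i.

(* Only the first [P] of the [n] variables are permuted; the identity block keeps
   all the matrices of size [n], so that no index type has to be changed. *)
Definition padded_mx (e : 'I_n -> 'I_n -> abfun F n) :=
  \matrix_(i, j) if (j < P)%N then if (i < P)%N then e i j else 0 else (i == j)%:R.

(** All i with i + 1 < P are ascents of w, so f lies in the image of each such [pi_op] and is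
    symmetric in the first P variables. It can thus be taken out of the alternant of [weight * f],
    which equals that of the dominant product for the reversed permutation u; v is the code of u on
    these positions. *)
Lemma grassmannian_bialternant w (lam : seq int) f : is_grassmannian lam P w -> dg w f ->
  exists v : nat -> nat,
    [/\ forall j : nat, (j < P)%N -> (v j)%:Z = (P - j.+1)%:Z + lam`_j,
        forall j : nat, (v j <= n)%N
      & f * \det (padded_mx power_entry) = \det (padded_mx (shape_entry v))].
Proof.
case=> [_ w_first w_adj] fP.
have w_inc1 x y : (x < y)%N -> (y < P)%N -> (w x < w y)%N.
  apply: (@increasing_of_adjacent 0) => // i j ji _ jP; apply: w_adj => //.
  by rewrite ltn_eqF.
have w_inc2 x y : (P <= x)%N -> (x < y)%N -> (w x < w y)%N.
  move=> Px lt_xy; apply: (@increasing_of_adjacent P n) => // i j ji Pi _; apply: w_adj => //.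
  by rewrite ji gtn_eqF.
pose u := (rev_first_perm * w)%g.
have uE x : u x = w (rev_first x) by rewrite permM permE.
have uw x : (P <= x)%N -> w x = u x by move=> Px; rewrite uE rev_first_id.
have u_dec x y : (x < y)%N -> (y < P)%N -> (u y < u x)%N.
  move=> lt_xy yP; rewrite !uE; have xP := ltn_trans lt_xy yP.
  by apply: w_inc1; rewrite !rev_firstE //; lia.
have u_inc x y : (P <= x)%N -> (x < y)%N -> (u x < u y)%N.
  move=> Px lt_xy; rewrite -!uw ?w_inc2 //.
  by apply: leq_trans Px (ltnW _).
have codeE := code_dominant_shape u_dec u_inc.
have dom : dominant u.
  move=> i j le_ij; rewrite !codeE; have [jP|//] := ltnP j P.
  rewrite (leq_ltn_trans le_ij jP); move: le_ij; rewrite leq_eqVlt => /predU1P[/val_inj->//|lt_ij].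
  by rewrite ltnW // u_dec.
pose v (j : nat) := if insub j is Some x then u x : nat else 0%N.
have vE x : v x = u x by rewrite /v valK.
exists v; split=> [j jP|j|].
- have ltj : (j < n)%N by apply: leq_trans le_Pn.
  rewrite -[j in v j]/(val (Ordinal ltj)) vE uE w_first; last by rewrite rev_firstE //=; lia.
  rewrite rev_firstE //=; congr (_ + nth _ _ _); lia.
- by rewrite /v; case: insub => // x; apply: ltnW.
have sym s : first_perm P s -> aact s f = f.
  apply: adjacent_invariant => i j ji jP.
  have lt_w : (w i < w j)%N by apply: w_inc1; rewrite // ji.
  have [h hP] := double_groth_exists F (tperm i j * w)%g.
  by rewrite (double_groth_uniq fP (double_groth_pi ji lt_w hP)) aact_pi_op.
rewrite /padded_mx -!alternant_det; last 2 first.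
- by move=> s i j; rewrite /shape_entry rmorphM rmorphXn fmorphV /= aact_avar aact_row_factor.
- by move=> s i j; rewrite /power_entry rmorphXn fmorphV /= aact_avar.
rewrite -alternantM // mulrC (alternant_double_groth uw u_dec fP (double_groth_dominant F dom)).
congr (alternant _); rewrite /weight /shape_entry big_split /=; congr (_ * _).
rewrite [RHS]big_mkcond; apply: eq_bigr => x _; rewrite codeE -vE.
by case: ifP => // _; rewrite /row_factor big1.
Qed.

End Grassmannian.

(** * Truncation and comparison with residues *)

(** The quotient x div B gives a Laurent polynomial, without total residue. The remainder over
    z^(i+1) B is O(z^-2) at infinity, and at 0 its residue is the coefficient of z^i in (x mod B) /
    B, with b standing for 1 / B. *)
Lemma res0oo_mod (F : fieldType) (x B b c : {poly F}) i :
  B`_0 = 1 -> B * b = 1 + 'X^(i.+1) * c ->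
  res0oo (x%:F / ('X^(i.+1) * B)%:F) = ((x %% B) * b)`_i.
Proof.
move=> B0 Bb; have Bn0 : B`_0 != 0 by rewrite B0 oner_eq0.
have B_neq0 := coef0_neq0_poly Bn0; set rho := x %% B.
have szrho : (size rho < size B)%N by rewrite ltn_modp.
(* s is the Taylor polynomial of rho / B up to z^i, and t the numerator of what is left. *)
pose s := take_poly i.+1 (rho * b); pose d := drop_poly i.+1 (rho * b).
pose t := d * B - c * rho.
have rhoE : 'X^(i.+1) * t = rho - s * B.
  have e : rho * (B * b) = (s + d * 'X^(i.+1)) * B by rewrite poly_take_drop; ring.
  have rho1 : rho = rho * (B * b) - 'X^(i.+1) * c * rho by rewrite Bb; ring.
  have -> : rho - s * B = rho * (B * b) - 'X^(i.+1) * c * rho - s * B by rewrite -rho1.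
  by rewrite e /t; clearbody s d; ring.
have szt : (size t < size B)%N.
  have [->|t0] := eqVneq t 0; first by rewrite size_poly0 size_poly_gt0.
  have : (size ('X^(i.+1) * t)%R <= i + size B)%N.
    rewrite rhoE (leq_trans (size_polyD _ _)) // geq_max size_polyN.
    rewrite (leq_trans (ltnW szrho)) ?leq_addl //=.
    apply: leq_trans (size_polyMleq _ _) _.
    rewrite -subn1 leq_subLR addnA leq_add2r add1n; exact: size_take_poly.
  by rewrite size_mul ?Xn_neq0 // size_polyXn addSn /= addSn -addnS leq_add2l.
have -> : x%:F / ('X^(i.+1) * B)%:F = (x %/ B + s)%:F / 'X%:F ^+ i.+1 + t%:F / B%:F.
  rewrite polarpart_frac //; congr (_%:F / _).
  rewrite [LHS](divp_eq x B) -/rho mulrDl -addrA; congr (_ + _).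
  by rewrite [t * _]mulrC rhoE addrC subrK.
rewrite res0ooE //; have szB : size B = (size B).-1.+1 by rewrite prednK // size_poly_gt0.
have : ('X^(i.+1) * t)`_(i + (size B).-1) = - (s`_i * lead_coef B).
  rewrite rhoE coefB [rho`__]nth_default ?sub0r; last first.
    by rewrite (@leq_trans (size B).-1) ?leq_addl // -ltnS -szB.
  by congr (- _); rewrite coefM_top -?szB ?size_take_poly // lead_coefE.
rewrite exprSr -mulrA coefXnM ltnNge leq_addr /= addKn => ->.
rewrite mulNr opprK mulfK ?lead_coef_eq0 // coef_take_poly ltnSn //.
Qed.

(** The last n - r columns vanish above the diagonal and are 1 on it, so they can be expanded away
    one at a time. *)
Lemma det_unit_lower (R : comNzRingType) (e : nat -> nat -> R) r n : (r <= n)%N ->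
  (forall i j, (r <= j)%N -> (j < n)%N -> (i <= j)%N -> e i j = (i == j)%:R) ->
  \det (\matrix_(i < n, j < n) e i j) = \det (\matrix_(i < r, j < r) e i j).
Proof.
elim: n => [|n IHn]; first by rewrite leqn0 => /eqP->.
rewrite leq_eqVlt => /predU1P[->//|]; rewrite ltnS => le_rn eE.
rewrite -(IHn le_rn) => [|i j rj jn]; last by apply: eE => //; apply: leqW.
rewrite (expand_det_col _ ord_max) (bigD1 ord_max) //= big1 ?addr0 => [|i neq_i].
  rewrite !mxE /= eE ?eqxx // mul1r /cofactor addnn -signr_odd odd_double mul1r.
  by congr (\det _); apply/matrixP => i j; rewrite !mxE !lift_max.
rewrite !mxE /= eE ?leq_ord // (_ : (_ == _) = false) ?mul0r //.
by apply: contraNF neq_i => /eqP e0; apply/eqP/val_inj.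
Qed.

Section PartitionResidue.
Variables (F : fieldType) (k l : nat) (alpha : k.-tuple F) (beta : l.-tuple F).

Lemma onemX_shift (e : int) (x y : nat) : e = x%:Z - y%:Z ->
  (1 - 'X) ^+ x * onemX_den F e = onemX_num F e * (1 - 'X) ^+ y.
Proof.
case: e => m E; rewrite /onemX_num /onemX_den.
  by rewrite mulr1 -exprD; congr (_ ^+ _); lia.
by rewrite mul1r -exprD; congr (_ ^+ _); move: E; rewrite NegzE; lia.
Qed.

Lemma inverse_mod_Xn (B : {poly F}) m : B`_0 = 1 ->
  exists b c : {poly F}, b`_0 = 1 /\ B * b = 1 + 'X^m * c.
Proof.
(* For m = 0 the congruence is empty; b = 1 secures the constant term. *)
move=> B0; case: m => [|m].
  by exists 1, (B - 1); rewrite coef1 mulr1 expr0 mul1r addrC subrK.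
have B0' : B`_0 != 0 by rewrite B0 oner_eq0.
have [b [c e]] := coprime_Xn_split m.+1 1 B0'; exists b, (- c); split.
  have := congr1 (fun p : {poly F} => p`_0) e.
  by rewrite coef1 coefD coefMXn coef0M B0 mulr1 addr0.
by rewrite e; ring.
Qed.

(** The exponent lam_j - (j + 1) - l + k of 1 - z in the residue entry equals (v_j - l) - (P - k),
    so the function there is x_j / (z^(i+1) B) and [res0oo_mod] applies. *)
Lemma g_residue_partition (lam : seq int) (P : nat) (v : nat -> nat) (B : {poly F})
    (x : nat -> {poly F}) :
  (size lam <= P)%N -> (k <= P)%N ->
  (forall j, (j < size lam)%N -> (l <= v j)%N /\ (v j)%:Z = (P - j.+1)%:Z + lam`_j) ->
  B = linear_prod alpha * (1 - 'X) ^+ (P - k) ->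
  (forall j, (j < size lam)%N -> x j = 'X^j * (linear_prod beta * (1 - 'X) ^+ (v j - l))) ->
  g_residue alpha beta lam = \det (\matrix_(i < size lam, j < size lam) (x j %% B)`_i).
Proof.
set r := size lam => le_rP le_kP vE BE xE; rewrite g_residue_det.
have B0 : B`_0 = 1 by rewrite BE coef0M linear_prod_coef0 oneBXn_coef0 mulr1.
have Bn0 : B != 0 by apply: coef0_neq0_poly; rewrite B0 oner_eq0.
have [b [c [b0 Bb]]] := inverse_mod_Xn r B0.
(* Toeplitz matrix of the series 1 / B: multiplying a remainder by b is a product with U. *)
pose U : 'M[F]_r := \matrix_(i, t) if (t <= i)%N then b`_(i - t) else 0.
have detU : \det U = 1.
  rewrite det_trig; last by apply/is_trig_mxP => i j lt_ij; rewrite mxE leqNgt lt_ij.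
  by rewrite big1 // => i _; rewrite mxE leqnn subnn.
rewrite -[RHS]mul1r -detU -det_mulmx; congr (\det _); apply/matrixP => i j; rewrite !mxE.
have [le_lv vjE] := vE j (ltn_ord j).
have -> : res_entry alpha beta (lam`_j - j.+1%:Z) i j = res0oo ((x j)%:F / ('X^(i.+1) * B)%:F).
  have den0 := mulf_neq0 (Xn_neq0 F i.+1) (psi_den_neq0 l alpha (lam`_j - j.+1%:Z)).
  have XB0 := mulf_neq0 (Xn_neq0 F i.+1) Bn0.
  congr res0oo; apply/eqP; rewrite (eq_tofrac_div _ _ den0 XB0).
  rewrite xE // BE /psi_num /psi_den; set e := _ - l%:Z + k%:Z.
  have /onemX_shift eE : e = (v j - l)%N%:Z - (P - k)%N%:Z.
    by rewrite /e; have := ltn_ord j; move: vjE le_lv le_kP le_rP; rewrite -/r; lia.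
  apply/eqP; move: (onemX_den F e) (onemX_num F e) eE => D N eE.
  transitivity ('X^j * 'X^(i.+1) * linear_prod beta * linear_prod alpha * (N * (1 - 'X) ^+ (P - k))).
    by ring.
  by rewrite -eE; ring.
(* One inverse of B modulo X^r serves every row i < r. *)
have [c' Bb'] : exists c', B * b = 1 + 'X^(i.+1) * c'.
  exists ('X^(r - i.+1) * c); rewrite Bb mulrA -exprD subnKC //.
rewrite (res0oo_mod _ B0 Bb') coefM.
rewrite (big_ord_widen r (fun t => (x j %% B)`_t * b`_(i - t))) // big_mkcond.
apply: eq_bigr => t _; rewrite !mxE ltnS; case: leqP => _; last by rewrite mul0r.
by rewrite mulrC.
Qed.
End PartitionResidue.

Lemma map_prod_oneBX (R S : comNzRingType) (phi : {rmorphism R -> S}) (n c : nat)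
    (a : 'I_n -> R) :
  map_poly phi (\prod_(x < n | (x < c)%N) (1 - a x *: 'X))
    = \prod_(x < n | (x < c)%N) (1 - phi (a x) *: 'X).
Proof.
rewrite rmorph_prod; apply: eq_bigr => x _.
by rewrite rmorphB rmorph1 /= map_polyZ map_polyX.
Qed.

Lemma horner_prod_oneBX (R : comNzRingType) (n c : nat) (a : 'I_n -> R) z :
  (\prod_(x < n | (x < c)%N) (1 - a x *: 'X)).[z] = \prod_(x < n | (x < c)%N) (1 - a x * z).
Proof. by rewrite horner_prod; apply: eq_bigr => x _; rewrite !hornerE. Qed.

Lemma size_prod_oneBX_leq (R : comNzRingType) (n c : nat) (a : 'I_n -> R) : (c <= n)%N ->
  (size (\prod_(x < n | (x < c)%N) (1 - a x *: 'X))%R <= c.+1)%N.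
Proof.
move=> le_cn; rewrite (big_ord_narrow le_cn).
have gen m (d : 'I_m -> R) : (size (\prod_(i < m) (1 - d i *: 'X))%R <= m.+1)%N.
  elim: m d => [|m IHm] d; first by rewrite big_ord0 size_poly1.
  rewrite big_ord_recr /=; apply: leq_trans (size_polyMleq _ _) _.
  have sz2 : (size (1 - d ord_max *: 'X)%R <= 2)%N.
    rewrite (leq_trans (size_polyD _ _)) // geq_max size_poly1 size_polyN.
    by rewrite (leq_trans (size_scale_leq _ _)) // size_polyX.
  rewrite -subn1 leq_subLR; apply: leq_trans (leq_add (IHm _) sz2) _.
  by rewrite addn2 add1n.
exact: (gen c (fun x => a (widen_ord le_cn x))).
Qed.

Lemma coef0_prod_oneBX (R : comNzRingType) (n c : nat) (a : 'I_n -> R) :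
  (\prod_(x < n | (x < c)%N) (1 - a x *: 'X))`_0 = 1.
Proof.
by rewrite -horner_coef0 horner_prod_oneBX big1 // => x _; rewrite mulr0 subr0.
Qed.

Lemma prod_oneBX_nth (F : fieldType) (s : seq F) (n c : nat) : (size s <= c)%N -> (c <= n)%N ->
  \prod_(x < n | (x < c)%N) (1 - nth 1 s x *: 'X) = linear_prod s * (1 - 'X) ^+ (c - size s).
Proof.
move=> le_sc le_cn; rewrite (big_ord_narrow le_cn) /=.
rewrite -(big_mkord xpredT (fun x => 1 - nth 1 s x *: 'X)) (@big_cat_nat _ _ _ (size s)) //=.
congr (_ * _); first by rewrite /linear_prod [RHS](big_nth 1).
rewrite big_nat_cond (eq_bigr (fun=> 1 - 'X)) => [|x /andP[/andP[le_sx _] _]].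
  by rewrite -big_nat_cond prodr_const_nat.
by rewrite nth_default // scale1r.
Qed.

Lemma eq_div_of_mul (L : fieldType) (f V c d : L) : V != 0 -> c != 0 ->
  c * (f * V) = V * d -> f = d / c.
Proof.
move=> V0 c0 E; apply: (mulIf V0); apply: (mulfI c0); rewrite E mulrC.
by field.
Qed.

Lemma det_power_entry_neq0 (F : fieldType) (n P : nat) : (P <= n)%N ->
  \det (padded_mx P (@power_entry F n)) != 0.
Proof.
move=> le_Pn; pose z (i : nat) : abfun F n := if insub i is Some x then (avar F x)^-1 else 0.
have zE (i : 'I_n) : z i = (avar F i)^-1 by rewrite /z valK.
pose e (i t : nat) : abfun F n :=
  if (t < P)%N then if (i < P)%N then z i ^+ t else 0 else (i == t)%:R.
have -> : padded_mx P (@power_entry F n) = \matrix_(i < n, t < n) e i t.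
  by apply/matrixP => i t; rewrite !mxE /e zE.
rewrite (@det_unit_lower _ e P) //; last first.
  by move=> i t Pt _ _; rewrite /e ltnNge Pt.
have -> : \matrix_(i < P, t < P) e i t = (Vandermonde P (\row_(i < P) z i))^T.
  by apply/matrixP => i t; rewrite !mxE /e !ltn_ord.
rewrite det_tr det_Vandermonde; apply/prodf_neq0 => i _; apply/prodf_neq0 => j lt_ij.
rewrite !mxE subr_eq0 -[i : nat]/(val (widen_ord le_Pn i)) -[j : nat]/(val (widen_ord le_Pn j)).
rewrite !zE (inj_eq invr_inj) avar_neq // -val_eqE /= gtn_eqF //.
Qed.

(** * Regularity and value at the truncation point *)

Section StableValue.
Variables (F : fieldType) (k l : nat) (alpha : k.-tuple F) (beta : l.-tuple F).
Hypothesis alpha0 : all (fun c => c != 0) alpha.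
Variables (n P : nat) (lam : seq int) (w : 'S_n) (f : abfun F n).
Hypotheses (le_Pn : (P <= n)%N) (lam_part : is_partition lam).
Hypotheses (le_kP : (k <= P)%N) (le_rlP : (size lam + l <= P)%N).
Hypotheses (w_grass : is_grassmannian lam P w) (fP : double_groth w f).
Local Notation R := {mpoly F[n + n]}.
Local Notation pt := (@truncation_point F k l alpha beta n).
Local Notation phi := (meval pt).

Let a (x : 'I_n) : R := 'X_(lshift n x).
Let b (x : 'I_n) : R := 'X_(rshift n x).
(** Coefficients stay in the polynomial ring, not in its fraction field, so that [phi] can be
    applied to them. *)
Let B : {poly R} := \prod_(x < n | (x < P)%N) (1 - a x *: 'X).
Let shape (c j : nat) : {poly R} := 'X^j * \prod_(x < n | (x < c)%N) (1 - b x *: 'X).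

Lemma meval_truncation_alpha x : phi (a x) = nth 1 alpha x.
Proof.
rewrite /a mevalXU /truncation_point.
by case: (split_ordP (lshift n x)) => [j /lshift_inj <-//|j /eqP]; rewrite eq_lrshift.
Qed.

Lemma meval_truncation_beta x : phi (b x) = nth 1 beta x.
Proof.
rewrite /b mevalXU /truncation_point.
by case: (split_ordP (rshift n x)) => [j /eqP|j /rshift_inj <-//]; rewrite eq_rlshift.
Qed.

Lemma map_alpha_poly : map_poly phi B = linear_prod alpha * (1 - 'X) ^+ (P - k).
Proof.
rewrite map_prod_oneBX; have := @prod_oneBX_nth F alpha n P; rewrite size_tuple => <- //.
by apply: eq_bigr => x _; rewrite -meval_truncation_alpha.
Qed.

Lemma map_shape_poly c j : (l <= c)%N -> (c <= n)%N ->
  map_poly phi (shape c j) = 'X^j * (linear_prod beta * (1 - 'X) ^+ (c - l)).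
Proof.
move=> le_lc le_cn; rewrite rmorphM /= map_polyXn map_prod_oneBX; congr (_ * _).
have := @prod_oneBX_nth F beta n c; rewrite size_tuple => <- //.
by apply: eq_bigr => x _; rewrite -meval_truncation_beta.
Qed.

Lemma size_map_alpha_poly : size (map_poly phi B) = P.+1.
Proof.
rewrite map_alpha_poly onemX_linear_prod -linear_prod_cat size_linear_prod.
  by rewrite size_cat size_nseq size_tuple subnKC.
by rewrite all_cat alpha0 all_nseq oner_eq0 orbT.
Qed.

Lemma size_alpha_poly : size B = P.+1.
Proof.
(* Evaluation can only lower the size, so the image bounds the size of B from below. *)
apply/eqP; rewrite eqn_leq size_prod_oneBX_leq //= -size_map_alpha_poly.
exact: size_poly.
Qed.

Lemma lead_alpha_poly_neq0 : phi (lead_coef B) != 0.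
Proof.
rewrite lead_coefE size_alpha_poly /= -coef_map.
have -> : P = (size (map_poly phi B)).-1 by rewrite size_map_alpha_poly.
by rewrite -lead_coefE lead_coef_eq0 -size_poly_gt0 size_map_alpha_poly.
Qed.

Lemma alpha_poly_neq0 : B != 0.
Proof. by rewrite -size_poly_gt0 size_alpha_poly. Qed.

Let ev (i : 'I_n) (p : {poly R}) : abfun F n :=
  (map_poly (@FracField.tofrac _) p).[(avar F i)^-1].

Lemma horner_alpha_poly (i : 'I_n) : (i < P)%N -> ev i B = 0.
Proof.
move=> iP; rewrite /ev map_prod_oneBX horner_prod_oneBX (bigD1 i) //=.
by rewrite divff ?subrr ?mul0r // avar_neq0.
Qed.

Lemma horner_shape_poly i c j : ev i (shape c j) = (avar F i)^-1 ^+ j * row_factor F c i.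
Proof.
by rewrite /ev rmorphM hornerM /= map_polyXn hornerXn map_prod_oneBX horner_prod_oneBX.
Qed.

Lemma horner_size_leq i (rho : {poly R}) : (size rho <= P)%N ->
  ev i rho = \sum_(t < n | (t < P)%N) (rho`_t)%:F * (avar F i)^-1 ^+ t.
Proof.
move=> szr; rewrite (big_ord_narrow le_Pn) /ev (@horner_coef_wide _ P).
  by apply: eq_bigr => t _; rewrite coef_map.
exact: leq_trans (size_poly _ _) szr.
Qed.

(** The Vandermonde determinant, which may vanish at the point, is cancelled beforehand in the
    function field. This leaves f as det C over a product of powers of the leading coefficient of B,
    and that denominator is nonzero at the point. *)
Lemma truncated_value :
  has_value f pt (g_residue alpha beta lam).
Proof.
have [v [vE le_vn fE]] := grassmannian_bialternant le_Pn w_grass fP.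
have [lam_sorted lam_ge0] := andP lam_part.
pose r := size lam.
have le_rP : (r <= P)%N by apply: leq_trans le_rlP; apply: leq_addr.
have lam_nth j : 0 <= lam`_j.
  have [lt_jr|le_rj] := ltnP j r; last by rewrite nth_default.
  by apply: (allP lam_ge0); apply: mem_nth.
(* Here v_j >= P - r >= l, so every untruncated beta occurs in the first r columns. *)
have v_lo j : (j < r)%N -> (l <= v j)%N.
  move=> lt_jr; have := vE j (leq_trans lt_jr le_rP); have := lam_nth j.
  by move: lt_jr le_rlP; rewrite -/r; lia.
have v_hi j : (r <= j)%N -> (j < P)%N -> (v j + j < P)%N.
  by move=> le_rj lt_jP; have := vE j lt_jP; rewrite nth_default //; lia.
pose rho j := shape (v j) j %% B; pose K j := scalp (shape (v j) j) B.
have divE j : lead_coef B ^+ K j *: shape (v j) j = shape (v j) j %/ B * B + rho j.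
  exact: Pdiv.WeakIdomain.divp_eq.
have sz_rho j : (size (rho j) <= P)%N.
  by rewrite -ltnS -size_alpha_poly Pdiv.CommonIdomain.ltn_modp alpha_poly_neq0.
pose c (j : nat) : R := if (j < P)%N then lead_coef B ^+ K j else 1.
pose C : 'M[R]_n := \matrix_(t, j)
  if (j < P)%N then if (t < P)%N then (rho j)`_t else 0 else (t == j)%:R.
(* At 1 / alpha_i, a root of B, the polynomial [shape (v j) j] times c_j agrees with its
   pseudo-remainder; so the scaled shape matrix is the power matrix times C. *)
have detE : (\prod_(j < n) (c j)%:F) * (f * \det (padded_mx P (@power_entry F n)))
          = \det (padded_mx P (@power_entry F n)) * (\det C)%:F.
  rewrite fE -det_scale_cols -det_map_mx -det_mulmx; congr (\det _).
  apply/matrixP => i j; rewrite !mxE.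
  have [jP|Pj] := ltnP j P; last first.
    rewrite /c ltnNge Pj /= rmorph1 mul1r (bigD1 j) //= big1 ?addr0 => [|t neq_tj].
      by rewrite !mxE !ltnNge Pj /= eqxx rmorph1 mulr1.
    by rewrite !mxE !ltnNge Pj /= (negPf neq_tj) rmorph0 mulr0.
  have [iP|Pi] := ltnP i P; last first.
    rewrite mulr0 big1 // => t _; rewrite !mxE jP.
    by have [tP|_] := ltnP t P; rewrite ?rmorph0 ?mulr0 // ltnNge Pi /= mul0r.
  rewrite /c jP /shape_entry -horner_shape_poly.
  transitivity (ev i (rho j)).
    have := congr1 (ev i) (divE j); rewrite {1}/ev map_polyZ hornerZ => ->.
    by rewrite /ev rmorphD rmorphM hornerD hornerM /= -/(ev i B) horner_alpha_poly // mulr0 add0r.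
  rewrite horner_size_leq // big_mkcond; apply: eq_bigr => t _; rewrite !mxE jP.
  by case: ifP => tP; rewrite ?iP ?rmorph0 ?mulr0 // mulrC.
have c_neq0 j : phi (c j) != 0.
  rewrite /c; case: ifP => _; last by rewrite rmorph1 oner_eq0.
  by rewrite rmorphXn expf_neq0 // lead_alpha_poly_neq0.
have prodc_neq0 : phi (\prod_(j < n) c j) != 0.
  by rewrite rmorph_prod; apply/prodf_neq0 => j _; apply: c_neq0.
exists (\det C), (\prod_(j < n) c j); split=> //.
  apply: (@eq_div_of_mul _ _ (\det (padded_mx P (@power_entry F n)))).
  - exact: det_power_entry_neq0.
  - by rewrite tofrac_eq0; apply: contraNneq prodc_neq0 => ->; rewrite rmorph0.
  - by rewrite rmorph_prod.
pose xi j := map_poly phi (shape (v j) j).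
(* The degree of B survives evaluation, so the evaluated identity is a Euclidean division over F,
   whose remainder is unique. *)
have rhoE j : map_poly phi (rho j) = phi (lead_coef B) ^+ K j *: (xi j %% map_poly phi B).
  rewrite -modpZl -rmorphXn -map_polyZ divE.
  apply: modpP; first by rewrite rmorphD rmorphM.
  by rewrite size_map_alpha_poly ltnS (leq_trans (size_poly _ _)).
pose e (t j : nat) : F :=
  if (j < P)%N then if (t < P)%N then (xi j %% map_poly phi B)`_t else 0 else (t == j)%:R.
have -> : (\det C).@[pt] = (\prod_(j < n) c j).@[pt] * \det (\matrix_(t < n, j < n) e t j).
  rewrite -det_map_mx rmorph_prod -det_scale_cols; congr (\det _).
  apply/matrixP => t j; rewrite !mxE /c /e; case: ifP => _; last by rewrite rmorph_nat rmorph1 mul1r.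
  case: ifP => _; last by rewrite rmorph0 mulr0.
  by rewrite -coef_map rhoE coefZ rmorphXn.
rewrite mulrC mulKf // (@det_unit_lower _ e r) ?(leq_trans le_rP) //; last first.
  move=> t j le_rj ltjn le_tj; rewrite /e; case: ltnP => // jP.
  rewrite (leq_ltn_trans le_tj jP) modp_small.
    rewrite /xi coef_map /shape coefXnM; case: ltngtP le_tj => // [lt_tj|->] _.
      by rewrite /= meval0.
    by rewrite subnn coef0_prod_oneBX /= meval1.
  rewrite size_map_alpha_poly ltnS (leq_trans (size_poly _ _)) // (leq_trans (size_polyMleq _ _)) //.
  have := size_prod_oneBX_leq b (le_vn j); rewrite size_polyXn /= => szb.
  by rewrite (leq_trans (leq_add (leqnn j) szb)) // addnS addnC v_hi.
rewrite (@g_residue_partition _ _ _ alpha beta lam P v (map_poly phi B) xi) //.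
- congr (\det _); apply/matrixP => t j; rewrite !mxE /e.
  by rewrite !(leq_trans (ltn_ord _) le_rP).
- by move=> j lt_jr; split; [exact: v_lo | exact: vE (leq_trans lt_jr le_rP)].
- exact: map_alpha_poly.
- by move=> j lt_jr; rewrite /xi map_shape_poly // v_lo.
Qed.

End StableValue.

(** * Grassmannian permutations and straightening *)

Lemma has_value_uniq (F : fieldType) n (f : {fraction {mpoly F[n]}}) (v : 'I_n -> F) x y :
  has_value f v x -> has_value f v y -> x = y.
Proof.
case=> [p [q [fE q0 ->]]] [p' [q' [fE' q'0 ->]]].
have nz (r : {mpoly F[n]}) : r.@[v] != 0 -> r != 0.
  by apply: contraNneq => ->; rewrite meval0.
move: fE'; rewrite fE => /eqP; rewrite eq_tofrac_div ?nz // => /eqP /(congr1 (meval v)).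
rewrite !mevalM => e; apply/eqP; rewrite eqr_div //; apply/eqP; rewrite e.
by [].
Qed.

Lemma partition_sorted_nth (lam : seq int) i j : is_partition lam -> (i <= j)%N ->
  lam`_j <= lam`_i.
Proof.
case/andP=> srt ge0 le_ij; have [lt_j|le_j] := ltnP j (size lam); last first.
  rewrite nth_default //; have [lt_i|le_i] := ltnP i (size lam); last by rewrite nth_default.
  by apply: (allP ge0); apply: mem_nth.
by apply: (sorted_leq_nth (@ge_trans _ _) (@lexx _ _) 0 srt) => //; rewrite inE (leq_ltn_trans le_ij).
Qed.

Lemma partition_ge0 (lam : seq int) i : is_partition lam -> 0 <= lam`_i.
Proof.
move=> part; apply: le_trans (partition_sorted_nth part (leq_maxr (size lam) i)).
by rewrite nth_default // leq_maxl.
Qed.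

Lemma partition_nth0 (lam : seq int) j : is_partition lam ->
  (count (fun a : int => a != 0%R) lam <= j)%N -> lam`_j = 0.
Proof.
move=> part le_cj; have [lt_j|] := ltnP j (size lam); last by move/(nth_default 0).
apply/eqP; apply: contraTT le_cj => nz; rewrite -ltnNge.
rewrite -[lam in count _ lam](cat_take_drop j.+1) count_cat.
have : all (fun a : int => a != 0%R) (take j.+1 lam).
  apply/(all_nthP 0) => i; rewrite size_takel // => lt_ij; rewrite nth_take //.
  apply: contraNneq nz => lam0; rewrite eq_le partition_ge0 // andbT.
  by rewrite -[X in _ <= X]lam0; apply: partition_sorted_nth.
rewrite all_count => /eqP ->; rewrite size_takel //; exact: leq_addr.
Qed.

Lemma grassmannian_exists (lam : seq int) : is_partition lam ->
  exists p n, exists w : 'S_n, is_grassmannian lam p w.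
Proof.
move=> part; set p := size lam.
pose m i := `|(lam`_i)%R|%N.
have mE i : (m i)%:Z = lam`_i by rewrite /m gez0_abs // partition_ge0.
have m_mono i j : (i <= j)%N -> (m j <= m i)%N.
  by move=> le_ij; rewrite -lez_nat !mE partition_sorted_nth.
(* The largest prescribed value, at position p - 1, is p - 1 + lam_1. *)
pose n := (p + m 0)%N; pose v i := (i + m (p - i.+1))%N.
have v_inc i j : (i < j)%N -> (v i < v j)%N.
  by move=> lt_ij; rewrite /v -addSn leq_add // m_mono // leq_sub2l // ltnS ltnW.
pose s1 := [seq v i | i <- iota 0 p]; pose s2 := [seq x <- iota 0 n | x \notin s1].
have s1n x : x \in s1 -> (x < n)%N.
  case/mapP=> i; rewrite mem_iota /= add0n => lt_ip ->.
  by rewrite /v /n -addSn leq_add // m_mono.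
have uniq_s1 : uniq s1.
  rewrite map_inj_uniq ?iota_uniq // => i j eq_v.
  by case: (ltngtP i j) => // /v_inc; rewrite eq_v ltnn.
have uniq_s : uniq (s1 ++ s2).
  rewrite cat_uniq uniq_s1 filter_uniq ?iota_uniq // andbT /=.
  by apply/hasPn => x; rewrite mem_filter => /andP[].
have size_s : size (s1 ++ s2) = n.
  rewrite -[RHS](size_iota 0); apply/perm_size/uniq_perm; rewrite ?iota_uniq // => x.
  rewrite mem_cat mem_filter mem_iota add0n /=.
  by case s1x : (x \in s1) => //=; rewrite s1n.
have size_s1 : size s1 = p by rewrite size_map size_iota.
have ltn_s i : (i < n)%N -> (nth 0%N (s1 ++ s2) i < n)%N.
  rewrite -{1}size_s => /(mem_nth 0%N); rewrite mem_cat mem_filter mem_iota.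
  by case/orP => [/s1n //|/andP[_ /andP[]]].
pose h (i : 'I_n) : 'I_n := Ordinal (ltn_s i (ltn_ord i)).
have h_inj : injective h.
  move=> i j /(congr1 val) /= /eqP; rewrite nth_uniq ?size_s // => /eqP.
  exact: val_inj.
have hE i : perm h_inj i = nth 0%N (s1 ++ s2) i :> nat by rewrite permE.
have h1 (i : 'I_n) : (i < p)%N -> perm h_inj i = v i :> nat.
  move=> lt_ip; rewrite hE nth_cat size_s1 lt_ip (nth_map 0%N) ?size_iota //.
  by rewrite nth_iota.
exists p, n, (perm h_inj); split=> [|i lt_ip|i j ji neq_jp].
- by rewrite count_size leq_addr.
- by rewrite h1 // /v PoszD mE.
have [lt_jp|le_pj] := ltnP j p; first by rewrite !h1 ?v_inc // ?ji // ltnW // -ji.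
have le_pi : (p <= i)%N by rewrite -ltnS -ji ltn_neqAle eq_sym neq_jp.
rewrite !hE !nth_cat size_s1 !ltnNge le_pi le_pj /=.
have srt : sorted ltn s2 by apply: sorted_filter; [exact: ltn_trans | exact: iota_ltn_sorted].
have sz2 x : (x < n)%N -> (p <= x)%N -> (x - p < size s2)%N.
  by move=> lt_xn le_px; rewrite ltn_subLR // -[(p + _)%N]addnC -{1}size_s1 addnC -size_cat size_s.
have /(_ (i - p)%N (j - p)%N) := sorted_ltn_nth ltn_trans 0%N srt.
by rewrite !inE !sz2 // -ltnNge => /(_ isT isT); apply; rewrite ji ltn_sub2r // ltnS.
Qed.

(** The m new fixed points correspond to m extra zero parts, so the descent can be moved as far
    right as needed. *)
Lemma grassmannian_shift (lam : seq int) p n (w : 'S_n) m : is_partition lam ->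
  is_grassmannian lam p w -> is_grassmannian lam (m + p) (shift_perm m w).
Proof.
move=> part [/andP[le_cp le_pn] w_first w_adj].
have lo (i : 'I_m) : shift_perm m w (lshift n i) = lshift n i.
  rewrite permE /shift_perm_fun; case: (split_ordP (lshift n i)) => [j /lshift_inj <-//|j /eqP].
  by rewrite eq_lrshift.
have hi (i : 'I_n) : shift_perm m w (rshift m i) = rshift m (w i).
  rewrite permE /shift_perm_fun; case: (split_ordP (rshift m i)) => [j /eqP|j /rshift_inj <-//].
  by rewrite eq_rlshift.
split=> [|i|i j].
- by rewrite (leq_trans le_cp) ?leq_addl //= leq_add2l.
- case: (split_ordP i) => i' -> lt_i.
    rewrite lo /= partition_nth0 ?addr0 // (leq_trans le_cp) //.
    by have := ltn_ord i'; lia.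
  rewrite hi /= !PoszD w_first; last by move: lt_i; rewrite /= ltn_add2l.
  by rewrite -addnS subnDl addrA.
case: (split_ordP i) => i' ->; case: (split_ordP j) => j' ->; rewrite ?lo ?hi /= => ji neq.
- by rewrite ji.
- by rewrite (leq_trans (ltn_ord _)) ?leq_addr.
- by have := ltn_ord j'; rewrite ji; lia.
rewrite ltn_add2l; apply: w_adj; last by apply: contraNneq neq => ->.
by move: ji; rewrite -addnS => /addnI.
Qed.

Lemma not_sortedP (T : Type) (r : rel T) (s : seq T) : ~~ sorted r s ->
  exists s1 x y s2, s = s1 ++ [:: x; y] ++ s2 /\ ~~ r x y.
Proof.
elim: s => [//|x [//|y s] IHs] /=; rewrite negb_and => /orP[nr|/IHs].
  by exists [::], x, y, s.
by move=> [s1 [x' [y' [s2 [-> nr]]]]]; exists (x :: s1), x', y', s2.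
Qed.

(* Base [d + 1] value of the word of the differences [b - x]: it decreases
   when the sequence grows lexicographically. *)
Fixpoint lex_weight (b : int) (d : nat) (s : seq int) : nat :=
  if s is x :: s' then (`|(b - x)%R| * d.+1 ^ size s' + lex_weight b d s')%N else 0%N.

Lemma lex_weight_cat b d s1 s2 :
  lex_weight b d (s1 ++ s2) = (lex_weight b d s1 * d.+1 ^ size s2 + lex_weight b d s2)%N.
Proof.
elim: s1 => //= x s1 IHs1.
by rewrite IHs1 size_cat expnD mulnDl addnA mulnA.
Qed.

Definition in_range (b : int) (d : nat) (x : int) := (b - d%:Z <= x) && (x <= b).

(** The digit at p drops by at least one, which outweighs any new following digit, as digits are at
    most d. *)
Lemma lex_weight_lt b d s1 s2 p q q' c : in_range b d p -> in_range b d q ->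
  in_range b d c -> p < q' -> q' <= q ->
  (lex_weight b d (s1 ++ [:: q'; c] ++ s2) < lex_weight b d (s1 ++ [:: p; q] ++ s2))%N.
Proof.
move=> /andP[_ pb] /andP[_ qb] /andP[dc cb] lt_pq le_q.
rewrite !lex_weight_cat /= ltn_add2l !addn0 expn1 expn0 !muln1 ltn_add2r.
have le1 : (`|(b - q')%R|.+1 <= `|(b - p)%R|)%N by lia.
have le2 : (`|(b - c)%R| < d.+1)%N by lia.
move: le1 le2; move: `|(b - q')%R|%N `|(b - p)%R|%N `|(b - c)%R|%N `|(b - q)%R|%N.
move=> x y z t le1 le2; have N0 : (0 < d.+1 ^ size s2)%N by rewrite expn_gt0.
rewrite ltn_mul2r N0 /=; apply: leq_trans (leq_addr _ _).
apply: leq_trans (leq_mul le1 (leqnn d.+1)); rewrite mulSn addnC ltn_add2r.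
exact: le2.
Qed.

Section Main.
Variables (F : fieldType) (k l : nat) (alpha : k.-tuple F) (beta : l.-tuple F).
Hypothesis alpha0 : all (fun c => c != 0) alpha.
Local Notation g := (g_residue alpha beta).
Local Notation sgs := (stable_groth_seq alpha beta).

Lemma stable_groth_value (lam : seq int) p n (w : 'S_n) m f : is_partition lam ->
  is_grassmannian lam p w -> (size lam + l + k <= m)%N ->
  double_groth (shift_perm m w) f -> has_value f (@truncation_point F k l alpha beta (m + n)) (g lam).
Proof.
move=> part grass le_m fP; have [/andP[_ le_pn] _ _] := grass.
have gr := grassmannian_shift m part grass.
(* The descent is now at m + p, so the bound on m supplies both lower bounds required of P. *)
apply: (truncated_value beta alpha0 _ part _ _ gr fP).
- by rewrite leq_add2l.
- by lia.
- by lia.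
Qed.

Lemma stable_groth_seq_value (I : seq int) x : sgs I x -> x = g I.
Proof.
elim=> {I x} [lam p n w x part grass [M MP]|I J p q x y lt_pq _ xE _ yE|I p x p0 _ ->].
- have [f [fP fx]] := MP (maxn M (size lam + l + k)) (leq_maxl _ _).
  exact: has_value_uniq fx (stable_groth_value part grass (leq_maxr _ _) fP).
- rewrite g_residue_straighten //; congr (_ - _); apply: eq_bigr => i _.
    by apply: xE; have := ltn_ord i; lia.
  by apply: yE; have := ltn_ord i; lia.
by rewrite g_residue_trailing.
Qed.

Lemma stable_groth_seq_partition (lam : seq int) : is_partition lam -> sgs lam (g lam).
Proof.
move=> part; have [p [n [w grass]]] := grassmannian_exists part.
apply: (sgs_partition part grass); exists (size lam + l + k)%N => m le_m.
have [f fP] := double_groth_exists F (shift_perm m w); exists f; split=> //.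
exact: stable_groth_value grass le_m fP.
Qed.

(** A weakly decreasing sequence may end in negative entries; stripping the nonpositive ones from
    the end leaves a partition. *)
Lemma stable_groth_seq_sorted (I : seq int) : sorted >=%R I -> sgs I (g I).
Proof.
elim/last_ind: I => [|I p IHI] srt; first exact: stable_groth_seq_partition.
have [p0|p0] := leP p 0.
  rewrite g_residue_trailing //; apply: sgs_trailing => //; apply: IHI.
  by apply: subseq_sorted srt => //; [exact: ge_trans | exact: subseq_rcons].
apply: stable_groth_seq_partition; apply/andP; split=> //.
rewrite all_rcons ltW //=; apply/allP => x xI.
move: srt; rewrite -cats1 (sorted_pairwise (@ge_trans _ _)) pairwise_cat => /and3P[/allrelP allr _ _].
by apply: le_trans (ltW p0) (allr x p xI _); rewrite inE.
Qed.

Lemma stable_groth_seq_g (I : seq int) : sgs I (g I).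
Proof.
(* The box containing all entries, possibly enlarged to include 0; new entries lie between p and q
   and stay in it. *)
pose b := foldr Num.max 0 I; pose a := foldr Num.min 0 I; pose d := `|(b - a)%R|%N.
have : all (in_range b d) I.
  have ub x : x \in I -> a <= x <= b.
    rewrite /a /b; elim: I {a b d} => // y I IHI; rewrite inE /= le_max ge_min.
    case/predU1P => [->|/IHI /andP[-> ->]]; rewrite ?lexx ?orbT //.
  apply/allP => x /ub; rewrite /in_range /d; lia.
clearbody d b; clear a; have [N] := ubnP (lex_weight b d I).
elim: N I => // N IHN I ltN rng.
have [srt|/not_sortedP[s1 [p [q [s2 [IE]]]]]] := boolP (sorted >=%R I).
  exact: stable_groth_seq_sorted.
rewrite -ltNge => lt_pq.
have [r1 [rp [rq r2]]] : all (in_range b d) s1 /\ in_range b d p /\ in_range b d q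
    /\ all (in_range b d) s2.
  by move: rng; rewrite IE all_cat /= => /and4P[].
have step q' c : p < q' -> q' <= q -> p < c -> c <= q ->
    sgs (s1 ++ [:: q'; c] ++ s2) (g (s1 ++ [:: q'; c] ++ s2)).
  move=> pq' q'q pc cq; have rc : in_range b d c by move: rp rq; rewrite /in_range; lia.
  have rq' : in_range b d q' by move: rp rq; rewrite /in_range; lia.
  apply: IHN; last by rewrite all_cat r1 /= rq' rc r2.
  by rewrite -ltnS; apply: leq_trans ltN; rewrite ltnS IE; apply: lex_weight_lt.
rewrite IE g_residue_straighten //.
apply: (sgs_straighten (x := fun c => g (s1 ++ [:: q; c] ++ s2))
                       (y := fun c => g (s1 ++ [:: q - 1; c] ++ s2))) => // c rc.
  by apply: step; lia.
by apply: step; lia.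
Qed.

End Main.

(** The equivalence contains the consistency of the definition: every sequence has a value, and all
    admissible choices lead to the same one. *)
Theorem theorem4p5 (F : fieldType) (I : seq int) (k l : nat)
    (alpha : k.-tuple F) (beta : l.-tuple F)
    (alpha_neq0 : forall i : 'I_k, tnth alpha i != 0)
    (beta_neq0 : forall j : 'I_l, tnth beta j != 0) :
  forall x : F, stable_groth_seq alpha beta I x <-> x = g_residue alpha beta I.
Proof.
have alpha0 : all (fun c => c != 0) alpha.
  by apply/allP => c /tnthP[i ->].
move=> x; split=> [|->]; first exact: stable_groth_seq_value.
exact: stable_groth_seq_g.
Qed.
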